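(* Let $M \subset \mathbb{C}^n$ be a $C^2$-smooth generic compact submanifold without boundary. Then its pluricomplex Green function $V_M$ is Lipschitz continuous in $\mathbb{C}^n$, i.e. there is a constant $A>0$ such that $|V_M(z)-V_M(w)|\le A|z-w|$ for all $z,w\in\mathbb{C}^n$.
   Context: A real smooth submanifold $M\subset\mathbb{C}^n$ is called generic if for each $z\in M$ its real tangent space $T_zM$ satisfies $T_zM+J\,T_zM=\mathbb{C}^n$, where $J$ is the standard complex structure on $\mathbb{C}^n$ (multiplication by $i$). Such a submanifold has real dimension $m\ge n$. The Lelong class $\mathcal{L}(\mathbb{C}^n)$ is the class of plurisubharmonic functions $u$ on $\mathbb{C}^n$ with $\sup\{u(z)-\log^+|z| : z\in\mathbb{C}^n\}<+\infty$. For a subset $E\subset\mathbb{C}^n$, its pluricomplex Green function is $$V_E(z):=\sup\{u(z): u\in\mathcal{L}(\mathbb{C}^n),\ u|_E\le 0\},\qquad z\in\mathbb{C}^n.$$ *)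

(* Defs.v *)
From HB Require Import structures.
From mathcomp Require Import all_boot all_order all_algebra.
From mathcomp Require Import complex.
From mathcomp Require Import all_classical all_reals all_analysis.

Set Implicit Arguments.
Unset Strict Implicit.
Unset Printing Implicit Defensive.

Import Order.TTheory GRing.Theory Num.Theory.
Import numFieldNormedType.Exports.

Local Open Scope classical_set_scope.
Local Open Scope ring_scope.

(* C^n as R^n + i R^n: the pair (x, y) stands for x + iy. This carries the
   normed R-module structure needed to speak of real differentiability; its
   library norm is a sup norm, so that the library topology is the usual one,
   but the Euclidean norm |z| is [enorm] below. *)
Definition Cn (R : realType) (n : nat) : normedModType R :=
  ('rV[R]_n * 'rV[R]_n)%type.

Section ComplexSpace.
Variables (R : realType) (n : nat).
Implicit Types z w : Cn R n.

(* multiplication by i *)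
Definition J z : Cn R n := (- z.2, z.1).

Definition scaleC (l : R[i]) z : Cn R n := complex.Re l *: z + complex.Im l *: J z.

Definition enorm z : R :=
  Num.sqrt (\sum_(j < n) (z.1 0 j ^+ 2 + z.2 0 j ^+ 2)).

End ComplexSpace.

Section Submanifolds.
Variables (R : realType) (n : nat).
Implicit Types (M U : set (Cn R n)) (f : Cn R n -> R).

(* U is meant to be open. In finite dimension, continuity of x |-> df_x is
   continuity of x |-> df_x(v) for every v. *)
Definition C1_on U f : Prop :=
  forall x, U x -> differentiable f x /\
    forall v : Cn R n, {for x, continuous (fun y => 'd f y v)}.

Definition C2_on U f : Prop :=
  C1_on U f /\ forall v : Cn R n, C1_on U (fun y => 'd f y v).

(* Embedded submanifold (without boundary) of real dimension m: near each of its
   points, M is the common zero set of 2n - m functions of class C^2 whose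
   differentials are linearly independent. *)
Definition C2_submanifold (m : nat) M : Prop :=
  (m <= n + n)%N /\
  forall p, M p -> exists (U : set (Cn R n)) (rho : 'I_(n + n - m) -> Cn R n -> R),
    [/\ open U, U p, forall j, C2_on U (rho j),
        forall z, U z -> (M z <-> forall j, rho j z = 0)
      & forall z, U z -> M z -> forall c : 'I_(n + n - m) -> R,
          (forall v : Cn R n, \sum_j c j * 'd (rho j) z v = 0) ->
          forall j, c j = 0].

(* T_zM, as the set of velocities at z of curves lying in M *)
Definition tangent_space M (z : Cn R n) : set (Cn R n) :=
  [set v | exists gamma : R -> Cn R n,
    [/\ gamma 0 = z, \forall t \near (0 : R), M (gamma t)
      & is_derive (0 : R) (1 : R) gamma v]].

Definition generic M : Prop :=
  forall z, M z -> forall w : Cn R n, exists u v : Cn R n,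
    [/\ tangent_space M z u, tangent_space M z v & w = u + J v].

End Submanifolds.

Section Pluripotential.
Variable R : realType.

Definition upper_semicontinuous (T : topologicalType) (f : T -> \bar R) : Prop :=
  lower_semicontinuous (fun x => - f x)%E.

(* R[i] is topologized through (s, t) |-> s + it. The function identically
   -oo is allowed here. A function f as in the first two clauses is bounded
   above on circles, so the integral is a well-defined element of [-oo, +oo[. *)
Definition subharmonic (f : R[i] -> \bar R) : Prop :=
  [/\ upper_semicontinuous (fun p : R * R => f (p.1 +i* p.2)%C),
      forall l, (f l < +oo)%E
    & forall (c : R[i]) (r : R), 0 < r ->
      (f c <= (((2 * pi)^-1)%R)%:E *
        \int[lebesgue_measure]_(t in `[0%R, (2 * pi)%R])
          f (c + r%:C%C * (cos t +i* sin t)%C)%R)%E].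

(* The function identically -oo is allowed; this does not change [green], as the
   supremum there is always over a family containing the constant 0. *)
Definition plurisubharmonic n (u : Cn R n -> \bar R) : Prop :=
  [/\ upper_semicontinuous u, forall z, (u z < +oo)%E
    & forall a b : Cn R n, subharmonic (fun l : R[i] => u (a + scaleC l b))].

Definition log_plus (x : R) : R := Num.max 0 (ln x).

Definition Lelong n : set (Cn R n -> \bar R) :=
  [set u | plurisubharmonic u /\
    (ereal_sup (range (fun z => u z - (log_plus (enorm z))%:E)) < +oo)%E].

Definition green n (E : set (Cn R n)) (z : Cn R n) : \bar R :=
  ereal_sup [set u z | u in
    [set u | Lelong u /\ forall x, E x -> (u x <= 0)%E]].

End Pluripotential.

(* Main.v *)
From mathcomp Require Import all_boot all_order all_algebra.
From mathcomp Require Import complex.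
From mathcomp Require Import all_classical all_reals all_analysis.
From mathcomp Require Import measurable_realfun.
From mathcomp Require Import ring lra.
Require Import Defs.

Set Implicit Arguments.
Unset Strict Implicit.
Unset Printing Implicit Defensive.

Import Order.TTheory GRing.Theory Num.Theory.
Import numFieldNormedType.Exports.

Local Open Scope classical_set_scope.
Local Open Scope ring_scope.

(** Call u admissible if u belongs to the Lelong class and u <= 0 on M, and let
    V be the supremum of the admissible functions.  Everything rests on one
    estimate: there are r1 > 0 and A such that u (p + h) <= A |h| for all
    admissible u, all p in M and all |h| <= r1 ([uniform_lipschitz]).  It makes
    z |-> u (z + h) - A |h| admissible again, so V (z + h) <= V z + A |h| for
    small h ([green_translate]), hence for all h by dividing h into small steps
    ([green_lipschitz]); finiteness of V follows, as V vanishes on M.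

    The estimate comes from restricting u to affine complex lines.  Genericity
    and compactness give a constant K such that every small h is, up to an error
    |h| / 8, of the form a + J b with a and b tangent to M at p, and the real
    line t |-> p + a + t b lies within K (1 + t^2) |h|^2 of M, because M is of
    class C^2 ([uniform_discs]).  The complex line l |-> p + h - J b + l b takes
    the value p + h at l = i, and its real points are close to M.  Suppose that
    u (p + h) <= B |h| + eta and u <= C0 near M.  Comparing u, on a box of the
    upper half plane of size comparable to 1 / |h|, with a superharmonic
    quadratic polynomial ([box_estimate]) improves this to
    u (p + h) <= (B / 2 + K1 C0) |h| + eta ([one_step]).  For every eta > 0 some
    B is available at the start, since u is upper semicontinuous and M is compact
    ([usc_start]); iterating and then letting eta tend to 0 yields
    u (p + h) <= 2 K1 C0 |h| ([lipschitz_near]).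

    This estimate also bounds C0 independently of u.  It gives u <= C0 / 2 on a
    fixed small ball, and a function of the Lelong class grows from a ball at a
    controlled rate ([ball_growth], an inequality of Bernstein and Walsh), so
    u <= C0 / 2 + c near M; the bound C0 can thus be decreased until it is about
    2 c.

    Two tools are used throughout.  The maximum principle [subharmonic_le]
    compares a subharmonic function with a barrier that has quadratic majorants
    of negative trace.  The estimate [lyusternik] of the distance to a zero set,
    proved by minimisation, moves points to M and also shows that the kernels
    of the differentials of the defining functions depend continuously on the
    point. *)

(** * Upper semicontinuous functions *)

Section USC.
Variables (R : realType) (T : topologicalType).

Lemma usc_near (f : T -> \bar R) x (a : R) : upper_semicontinuous f ->
  (f x < a%:E)%E -> \forall y \near x, (f y < a%:E)%E.
Proof.
move=> uf fxa; have [|V xV VP] := uf x (- a).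
  by rewrite EFinN lteN2.
by apply: filterS xV => y /VP; rewrite EFinN lteN2.
Qed.

Lemma usc_nearP (f : T -> \bar R) :
  (forall x (a : R), (f x < a%:E)%E -> \forall y \near x, (f y < a%:E)%E) ->
  upper_semicontinuous f.
Proof.
move=> h x a; rewrite lteNr -EFinN => /h fx.
by exists [set y | (f y < (- a)%:E)%E] => // y /=; rewrite lteNr -EFinN.
Qed.

(** If no maximum is attained, each value of f on K is exceeded by another one.
    The superlevel sets of f in K then generate a filter along which every
    f x is locally exceeded; compactness makes this uniform over K, which is
    absurd for the points of K themselves. *)
Lemma usc_max (f : T -> \bar R) (K : set T) : upper_semicontinuous f ->
  compact K -> K !=set0 -> exists2 c, K c & forall x, K x -> (f x <= f c)%E.
Proof.
move=> uf cK [x0 Kx0]; apply: contrapT => nmax.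
have {nmax} up x : K x -> exists2 y, K y & (f x < f y)%E.
  move=> Kx; apply: contrapT => ny; apply: nmax; exists x => // y Ky.
  by rewrite leNgt; apply/negP => xy; apply: ny; exists y.
have upr x : K x -> exists2 y, K y & exists2 a : R, (f x < a%:E)%E & (a%:E <= f y)%E.
  move=> Kx; have [y Ky xy] := up x Kx; exists y => //.
  have [z /andP[xz zy]] : exists z : R, (f x < z%:E <= f y)%E.
    move: xy; case: (f x) => [a| |] //; case: (f y) => [b| |] //.
    - by move=> ab; exists b; rewrite ab lexx.
    - by move=> _; exists (a + 1); rewrite lte_fin ltrDl ltr01 leey.
    - by move=> _; exists b; rewrite ltNyr lexx.
    - by move=> _; exists 0; rewrite ltNyr leey.
  by exists z.
(* the points of K of high value, as a filter *)
pose F : set_system T := [set A | exists2 y, K y & [set z | (f y <= f z)%E] `&` K `<=` A].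
have FF : Filter F.
  split.
  - by exists x0.
  - move=> P Q [y Ky yP] [z Kz zQ]; have [yz|/ltW zy] := leP (f y) (f z).
      exists z => // w [/= zw Kw]; split; last exact: zQ.
      by apply: yP; split => //=; exact: le_trans zw.
    exists y => // w [/= zw Kw]; split; first exact: yP.
    by apply: zQ; split => //=; exact: le_trans zw.
  - by move=> P Q PQ [y Ky yP]; exists y => // z /yP /PQ.
have /compact_near_coveringP/(_ T F (fun y x => (f x < f y)%E) FF) : compact K by [].
case=> [x Kx|y Ky yP].
  have [y Ky [a xa ay]] := upr x Kx.
  near=> x' y' => /=; apply: (@lt_le_trans _ _ a%:E).
    by near: x'; exact: usc_near.
  apply: le_trans ay _; near: y'.
  by exists y => // z [].
have [z Kz yz] := up y Ky.
have := yP y; rewrite /= lexx => /(_ (conj isT Ky)) /(_ _ Ky).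
by rewrite ltxx.
Unshelve. all: by end_near. Qed.

Lemma usc_bounded (f : T -> \bar R) (K : set T) : upper_semicontinuous f ->
  (forall x, (f x < +oo)%E) -> compact K ->
  exists2 a : R, 0 <= a & forall x, K x -> (f x <= a%:E)%E.
Proof.
move=> uf fy cK.
have [K0|nK] := pselect (K !=set0); last first.
  by exists 0 => // x Kx; exfalso; apply: nK; exists x.
have [c Kc cmax] := usc_max uf cK K0.
exists (`|fine (f c)|) => // x /cmax fx; apply: le_trans fx _.
by move: (fy c); case: (f c) => [a| |] //= _; rewrite ?lee_fin ?ler_norm ?leNye.
Qed.

End USC.

Section USCops.
Variables (R : realType) (T : topologicalType).

Lemma usc_cst (c : \bar R) : upper_semicontinuous (cst c : T -> \bar R).
Proof. by move=> x a ax; exists setT => //; exact: filterT. Qed.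

Lemma usc_comp (S : topologicalType) (f : T -> \bar R) (g : S -> T) :
  upper_semicontinuous f -> continuous g -> upper_semicontinuous (f \o g).
Proof.
move=> uf cg; apply: usc_nearP => x a fxa.
by have := usc_near uf fxa; exact: cg.
Qed.

Lemma usc_subr (f : T -> \bar R) (h : T -> R) :
  upper_semicontinuous f -> continuous h ->
  upper_semicontinuous (fun x => f x - (h x)%:E)%E.
Proof.
move=> uf ch; apply: usc_nearP => x a.
rewrite lteBlDr// -EFinD => fx.
have [b fb ba] : exists2 b : R, (f x < b%:E)%E & b < a + h x.
  move: fx; case: (f x) => [r| |] // ; last first.
    by move=> _; exists (a + h x - 1); rewrite ?ltNyr// ltrBlDr ltrDl.
  by rewrite lte_fin => /midf_lt[/= ? ?]; exists ((r + (a + h x)) / 2); rewrite ?lte_fin.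
near=> y; rewrite lteBlDr// -EFinD; apply: (@lt_trans _ _ b%:E).
  by near: y; exact: usc_near.
rewrite lte_fin -ltrBlDl; near: y.
by apply: (cvgr_gt (h x) (ch x)); rewrite ltrBlDl.
Unshelve. all: by end_near. Qed.

End USCops.

(** * Circle means and the maximum principle *)

Lemma continuous_pair (T U V : topologicalType) (f : T -> U) (g : T -> V) :
  continuous f -> continuous g -> continuous (fun t => (f t, g t)).
Proof. by move=> cf cg t; exact: (cvg_pair (cf t) (cg t)). Qed.

Section Integrals.
Context d (T : measurableType d) (R : realType) (mu : {measure set T -> \bar R}).
Variables (D : set T) (mD : measurable D) (g q : T -> \bar R).
Hypothesis (mg : measurable_fun D g) (iq : mu.-integrable D q).
Hypothesis gq : forall t, D t -> (g t <= q t)%E.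

(** The circle integral of a subharmonic function may be -oo; an integrable
    majorant leaves only this alternative to integrability. *)
Lemma integrable_or_ninfty :
  mu.-integrable D g \/ (\int[mu]_(t in D) g t = -oo)%E.
Proof.
have pos : (\int[mu]_(t in D) g^\+ t < +oo)%E.
  have := integral_funepos_lt_pinfty mD iq; apply: le_lt_trans.
  apply: ge0_le_integral => //.
  - exact: measurable_funepos.
  - by apply: measurable_funepos; exact: measurable_int iq.
  - move=> t Dt; apply: (@funepos_le _ _ D) => //; last by rewrite inE.
    by move=> s /set_mem; exact: gq.
have [neg|] := ltP (\int[mu]_(t in D) g^\- t)%E +oo%E.
  left; apply/integrableP; split => //.
  have := fune_abse g; rewrite /comp => ->.
  rewrite ge0_integralD//; [|exact: measurable_funepos|exact: measurable_funeneg].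
  exact: lte_add_pinfty.
rewrite leye_eq => /eqP neg; right; rewrite integralE neg.
by move: pos; case: (\int[mu]_(t in D) g^\+ t)%E.
Qed.

Lemma le_integral_integrable_r :
  (\int[mu]_(t in D) g t <= \int[mu]_(t in D) q t)%E.
Proof.
have [ig|->] := integrable_or_ninfty; last by rewrite leNye.
by apply: le_integral => // t /set_mem; exact: gq.
Qed.

End Integrals.

Section Means.
Variable R : realType.
Notation mu := (@lebesgue_measure R).

Lemma usc_measurable (f : R -> \bar R) : upper_semicontinuous f ->
  measurable_fun setT (f : measurableTypeR R -> \bar R).
Proof.
move=> /lower_semicontinuous_measurable mf.
have -> : f = (-%E \o (fun x => - f x))%E by apply/funext => x /=; rewrite oppeK.
exact: measurableT_comp.
Qed.

Lemma two_pi_gt0 : 0 < 2 * pi :> R.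
Proof. by rewrite mulr_gt0// pi_gt0. Qed.

(** A polynomial of degree 2 in two variables, restricted to the unit circle. *)
Definition trigq (a l1 l2 q11 q12 q22 t : R) : R :=
  a + (l1 * cos t + l2 * sin t)
    + (q11 * cos t ^+ 2 + q12 * (cos t * sin t) + q22 * sin t ^+ 2).

(** A primitive of [trigq]. *)
Definition trigQ (a l1 l2 q11 q12 q22 t : R) : R :=
  a * t + (l1 * sin t - l2 * cos t)
    + (q11 * ((t + sin t * cos t) / 2) + q12 * (sin t ^+ 2 / 2)
     + q22 * ((t - sin t * cos t) / 2)).

Lemma is_derive_trigQ a l1 l2 q11 q12 q22 (t : R) :
  is_derive t 1 (trigQ a l1 l2 q11 q12 q22) (trigq a l1 l2 q11 q12 q22 t).
Proof.
rewrite /trigQ; apply: is_derive_eq.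
rewrite /trigq /GRing.scale /=.
have h : sin t ^+ 2 = 1 - cos t ^+ 2 by rewrite sin2cos2.
set s := sin t in h *; set c := cos t in h *.
transitivity (a + (l1 * c + l2 * s) + (q11 * c ^+ 2 + q12 * (c * s) + q22 * s ^+ 2)
  + (q11 + q22) / 2 * (1 - s ^+ 2 - c ^+ 2)); first by field.
by rewrite h; ring.
Qed.

(** On a circle the linear part and the mixed term average to 0, and each square
    averages to 1/2: only the trace q11 + q22 is seen. *)
Lemma integral_trigq a l1 l2 q11 q12 q22 :
  (\int[mu]_(t in `[0%R, (2 * pi)%R]) (trigq a l1 l2 q11 q12 q22 t)%:E
   = (2 * pi * (a + (q11 + q22) / 2))%:E)%E.
Proof.
have dQ := is_derive_trigQ a l1 l2 q11 q12 q22.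
have cq : continuous (trigq a l1 l2 q11 q12 q22).
  move=> t; apply: differentiable_continuous; apply/derivable1_diffP.
  by rewrite /trigq.
rewrite (@continuous_FTC2 _ _ (trigQ a l1 l2 q11 q12 q22)) ?two_pi_gt0//.
- by rewrite -EFinB /trigQ mulr_natl cos2pi sin2pi cos0 sin0; congr (_%:E); field.
- exact: continuous_subspaceT.
- have cQ : continuous (trigQ a l1 l2 q11 q12 q22).
    by move=> t; apply/differentiable_continuous/derivable1_diffP.
  by split => [t _ //||]; [apply: cvg_at_right_filter|apply: cvg_at_left_filter]; exact: cQ.
- by move=> t _; rewrite derive1E; exact: derive_val.
Qed.

Lemma integrable_trigq a l1 l2 q11 q12 q22 :
  mu.-integrable `[0%R, (2 * pi)%R] (fun t => (trigq a l1 l2 q11 q12 q22 t)%:E).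
Proof.
apply: (@continuous_compact_integrable _ (trigq a l1 l2 q11 q12 q22)).
  exact: segment_compact.
apply: continuous_subspaceT => t; apply/differentiable_continuous/derivable1_diffP.
by rewrite /trigq.
Qed.

Lemma circleE (c : R[i]) (r t : R) :
  (c + r%:C%C * (cos t +i* sin t)%C)
    = ((complex.Re c + r * cos t) +i* (complex.Im c + r * sin t))%C.
Proof. by case: c => x y; simpc. Qed.

Lemma circle_usc (f : R[i] -> \bar R) (c : R[i]) (r : R) : subharmonic f ->
  upper_semicontinuous (fun t : R => f (c + r%:C%C * (cos t +i* sin t)%C)).
Proof.
case=> uf _ _.
pose g t : R * R := (complex.Re c + r * cos t, complex.Im c + r * sin t).
have -> : (fun t : R => f (c + r%:C%C * (cos t +i* sin t)%C)) =
    (fun p : R * R => f (p.1 +i* p.2)%C) \o g.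
  by apply/funext => t /=; rewrite circleE.
apply: usc_comp => //.
apply: continuous_pair => t; apply: cvgD.
- exact: cvg_cst.
- by apply: cvgM; [exact: cvg_cst|exact: continuous_cos].
- exact: cvg_cst.
- by apply: cvgM; [exact: cvg_cst|exact: continuous_sin].
Qed.

(** Subharmonicity in the viscosity sense: a quadratic polynomial lying above f
    on a circle, and at most f c at the centre, has nonnegative trace, by comparison
    of the means over the circle. *)
Lemma subharmonic_touch (f : R[i] -> \bar R) (c : R[i]) (a r l1 l2 q11 q12 q22 : R) :
  subharmonic f -> 0 < r -> (a%:E <= f c)%E ->
  (forall w1 w2 : R, w1 ^+ 2 + w2 ^+ 2 = r ^+ 2 ->
    (f ((complex.Re c + w1)%R +i* (complex.Im c + w2)%R)%C <=
     (a + (l1 * w1 + l2 * w2) +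
        (q11 * w1 ^+ 2 + q12 * (w1 * w2) + q22 * w2 ^+ 2))%:E)%E) ->
  0 <= q11 + q22.
Proof.
move=> sf r0 fc fq; have [_ _ mean] := sf.
have := le_trans fc (mean c r r0).
set I := (\int[_]_(_ in _) _)%E.
have : (I <= (2 * pi * (a + (r ^+ 2 * q11 + r ^+ 2 * q22) / 2))%:E)%E.
  rewrite -(integral_trigq a (r * l1) (r * l2) _ (r ^+ 2 * q12)).
  apply: le_integral_integrable_r => //.
  - by apply: measurable_funTS; apply: usc_measurable; exact: circle_usc.
  - exact: integrable_trigq.
  - move=> t _; rewrite circleE; apply: le_trans (fq _ _ _) _.
      by rewrite !exprMn -mulrDr cos2Dsin2 mulr1.
    by rewrite lee_fin /trigq le_eqVlt; apply/orP; left; apply/eqP; ring.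
move=> /(@lee_wpmul2l _ ((2 * pi)^-1)%:E).
rewrite lee_fin invr_ge0 (ltW two_pi_gt0) => /(_ isT) h /le_trans => /(_ _ h).
rewrite -EFinM lee_fin mulrA mulVf ?mul1r ?gt_eqF ?two_pi_gt0// lerDl.
by rewrite -mulrDr -mulrA pmulr_rge0 ?exprn_gt0// pmulr_lge0.
Qed.

(** Either f is integrable on the circle and the integral is additive, or the
    integral is -oo and then so is f c. *)
Lemma subharmonic_subr (f : R[i] -> \bar R) (k : R) : subharmonic f ->
  subharmonic (fun l => f l - k%:E)%E.
Proof.
move=> sf; have [uf fy mean] := sf; split => [||c r r0].
- by apply: (usc_subr (h := fun=> k)) uf _ => ?; exact: cvg_cst.
- by move=> l; case: (f l) (fy l) => [x| |] //= _; rewrite -EFinB ltry.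
set g := fun t : R => f (c + r%:C%C * (cos t +i* sin t)%C).
have ug : upper_semicontinuous g by exact: circle_usc.
have mg : measurable_fun (`[0%R, (2 * pi)%R] : set (measurableTypeR R)) g.
  by apply: measurable_funTS; exact: usc_measurable.
have [|b b0 gb] := usc_bounded ug _ (@segment_compact R 0 (2 * pi)).
  by move=> t; exact: fy.
have ik k' : mu.-integrable `[0%R, (2 * pi)%R] (cst k'%:E).
  have := integrable_trigq k' 0 0 0 0 0; apply: eq_integrable => //= t _.
  by rewrite /trigq !mul0r !addr0.
have [ig|gN] := @integrable_or_ninfty _ _ R mu `[0, (2 * pi)]%classic
  (measurable_itv _) g (cst b%:E) mg (ik b) gb.
  rewrite (_ : (\int[_]_(_ in _) _)%E =
    (\int[mu]_(t in `[0%R, (2 * pi)%R]) (g \- cst k%:E) t)%E)//.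
  rewrite integralB//.
  have -> : (\int[mu]_(t in `[0%R, (2 * pi)%R]) cst k%:E t = (2 * pi * k)%:E)%E.
    have := integral_trigq k 0 0 0 0 0; rewrite addr0 mul0r addr0 => <-.
    by apply: eq_integral => t _; rewrite /trigq !mul0r !addr0.
  rewrite muleBr// ?fin_num_adde_defl//.
  rewrite -EFinM mulrA mulVf ?mul1r ?gt_eqF ?two_pi_gt0//.
  by apply: leeB => //; exact: mean.
have := mean c r r0; rewrite -/g gN.
rewrite mulrNy gtr0_sg ?invr_gt0 ?two_pi_gt0// mul1e.
by rewrite leeNy_eq => /eqP ->; rewrite leNye.
Qed.

(** At a point where f - h is maximal over K, the quadratic majorant of h, moved by
    a constant, touches f from above, which [subharmonic_touch] excludes when the
    trace is negative.  Asking for majorants on one circle per point avoids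
    differentiating the barrier. *)
Lemma subharmonic_le (f : R[i] -> \bar R) (K : set (R * R)) (h : R * R -> R) :
  subharmonic f -> compact K -> continuous h ->
  (forall p, K p -> (f (p.1 +i* p.2)%C <= (h p)%:E)%E \/
    exists r l1 l2 q11 q12 q22 : R, [/\ 0 < r, q11 + q22 < 0
      & forall w1 w2 : R, w1 ^+ 2 + w2 ^+ 2 = r ^+ 2 ->
        K (p.1 + w1, p.2 + w2) /\
        h (p.1 + w1, p.2 + w2) <= h p + (l1 * w1 + l2 * w2) +
          (q11 * w1 ^+ 2 + q12 * (w1 * w2) + q22 * w2 ^+ 2)]) ->
  forall p, K p -> (f (p.1 +i* p.2)%C <= (h p)%:E)%E.
Proof.
move=> sf cK ch dich p Kp; have [uf fy _] := sf.
have ug := usc_subr uf ch.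
have [c Kc cmax] := usc_max ug cK (ex_intro _ p Kp).
suff hc : (f (c.1 +i* c.2)%C <= (h c)%:E)%E.
  by have := le_trans (cmax p Kp) (_ : _ <= 0)%E; rewrite !leeBlDr// !add0e; apply.
case: (dich c Kc) => // -[r [l1 [l2 [q11 [q12 [q22 [r0 q0 qh]]]]]]].
rewrite leNgt; apply/negP => hf.
have [a fa] : exists a, f (c.1 +i* c.2)%C = a%:E.
  by move: (fy (c.1 +i* c.2)%C) hf; case: (f _) => [a| |] // _ _; exists a.
have := @subharmonic_touch f (c.1 +i* c.2)%C a r l1 l2 q11 q12 q22 sf r0.
rewrite fa lexx leNgt q0 /= => H; suff: false by []. apply: H => //.
move=> w1 w2 /qh[Kw hw]; have := cmax _ Kw; rewrite fa -EFinB leeBlDr//.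
by move=> /le_trans; apply; rewrite -EFinD lee_fin; lra.
Qed.

End Means.
(** * Two barriers *)

Section Barriers.
Variable R : realType.

Lemma le_radius (w1 w2 r : R) : 0 <= r -> w1 ^+ 2 + w2 ^+ 2 = r ^+ 2 ->
  `|w1| <= r /\ `|w2| <= r.
Proof. by move=> r0 w; split; rewrite ler_norml; apply/andP; split; nra. Qed.

(** The barrier is a + G (x^2 - 2 y^2 + 3 T y) on the box |x| <= T, 0 <= y <= T.
    It is strictly superharmonic, is a + G x^2 on the bottom side and at least
    a + G T^2 on the three other sides.  A bound proportional to T G at the
    point i is what makes the contraction in [one_step] possible. *)
Lemma box_estimate (f : R[i] -> \bar R) (T G a C0 : R) : subharmonic f ->
  1 <= T -> 0 < G -> C0 <= a + G * T ^+ 2 ->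
  (forall x : R, `|x| <= T -> (f (x +i* 0%R)%C <= (a + G * x ^+ 2)%:E)%E) ->
  (forall x y : R, `|x| <= T -> 0 <= y -> y <= T -> (f (x +i* y)%C <= C0%:E)%E) ->
  (f (0%R +i* 1%R)%C <= (a + 3 * T * G)%:E)%E.
Proof.
move=> sf T1 G0 C0T fb fC.
pose K : set (R * R) := `[-T, T]%classic `*` `[0, T]%classic.
pose h (p : R * R) : R := a + G * (p.1 ^+ 2 - 2 * p.2 ^+ 2 + 3 * T * p.2).
have KE p : K p <-> [/\ -T <= p.1, p.1 <= T, 0 <= p.2 & p.2 <= T].
  rewrite /K /=; split.
    by case=> /=; rewrite !in_itv/= => /andP[-> ->] /andP[-> ->].
  by case=> a1 a2 a3 a4; split; rewrite /= in_itv/= ?a1 ?a2 ?a3 ?a4.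
have ch : continuous h.
  move=> p; rewrite /h; apply: cvgD; first exact: cvg_cst.
  have c1 : {for p, continuous (fun p : R * R => p.1)} by exact: cvg_fst.
  have c2 : {for p, continuous (fun p : R * R => p.2)} by exact: cvg_snd.
  apply: cvgM; first exact: cvg_cst.
  apply: cvgD; last by apply: cvgM; [exact: cvg_cst|exact: c2].
  apply: cvgB; first by rewrite /GRing.exp /=; apply: cvgM; exact: c1.
  by apply: cvgM; [exact: cvg_cst|apply: cvgM; exact: c2].
have : (f (0%R +i* 1%R)%C <= (h (0, 1)%R)%:E)%E.
  apply: (@subharmonic_le _ f K h sf _ ch _ (0, 1)).
  - by apply: compact_setX; exact: segment_compact.
  - move=> [x y] /KE/= [x1 x2 y1 y2].
    have xT : `|x| <= T by rewrite ler_norml x1.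
    have [y0|y0] := eqVneq y 0.
      by left; rewrite y0; apply: le_trans (fb x xT) _; rewrite lee_fin /h/=; nra.
    have yp : 0 < y by rewrite lt_neqAle eq_sym y0.
    have [yT|yT] := eqVneq y T.
      left; apply: le_trans (fC x y xT y1 y2) _; rewrite lee_fin /h/= yT.
      apply: le_trans C0T _; rewrite lerD2l ler_pM2l//; nra.
    have yTs : y < T by rewrite lt_neqAle yT.
    have [xT'|xT'] := eqVneq (x ^+ 2) (T ^+ 2).
      left; apply: le_trans (fC x y xT y1 y2) _; rewrite lee_fin /h/= xT'.
      apply: le_trans C0T _; rewrite lerD2l ler_pM2l//; nra.
    have xTs : `|x| < T.
      rewrite lt_neqAle xT andbT; apply: contra xT' => /eqP <-.
      by rewrite real_normK ?num_real.
    right; pose r := Num.min (T - `|x|) (Num.min y (T - y)).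
    have r0 : 0 < r by rewrite !lt_min yp !subr_gt0 xTs yTs.
    exists r, (G * (2 * x)), (G * (3 * T - 4 * y)), G, 0, (G * (-2)); split => //.
      lra.
    move=> w1 w2 w; have [w1r w2r] := le_radius (ltW r0) w.
    have [rx ry rT] : [/\ r <= T - `|x|, r <= y & r <= T - y].
      by rewrite /r !ge_min !lexx !orbT.
    move: w1r w2r; rewrite !ler_norml => /andP[w11 w12] /andP[w21 w22].
    have := ler_norm x; have := ler_norm (- x); rewrite normrN => n1 n2.
    split; first by apply/KE; split => /=; lra.
    by rewrite /h /= le_eqVlt; apply/orP; left; apply/eqP; ring.
  - by apply/KE; split => /=; lra.
move=> /le_trans; apply; rewrite lee_fin /h /=; nra.
Qed.

(** The derivative of the difference of the two sides at t is t^3 / (1 + t), which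
    has the sign of t. *)
Lemma ln1D_le (x : R) : -1 < x -> ln (1 + x) <= x - x ^+ 2 / 2 + x ^+ 3 / 3.
Proof.
move=> x1.
pose phi (t : R) := t - t ^+ 2 / 2 + t ^+ 3 / 3 - ln (1 + t).
have dphi (t : R) : -1 < t -> is_derive t 1 phi (t ^+ 3 / (1 + t)).
  move=> t1; have t0 : 0 < 1 + t by lra.
  have d : is_derive (1 + t) 1 (@ln R) (1 + t)^-1 by exact: is_derive1_ln.
  have d2 : is_derive t 1 (fun t => ln (1 + t)) (1 + t)^-1.
    have d1 : is_derive t 1 (fun t : R => 1 + t) 1 by apply: is_derive_eq; ring.
    by have := is_derive1_comp (f := @ln R) (g := fun t : R => 1 + t) d d1; rewrite mulr1.
  rewrite /phi; apply: is_derive_eq.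
  rewrite /GRing.scale /=; field; lra.
have cphi (t : R) : -1 < t -> {for t, continuous phi}.
  by move=> /dphi dt; apply/differentiable_continuous/derivable1_diffP.
have phi0 : phi 0 = 0 by rewrite /phi addr0 ln1; ring.
suff : 0 <= phi x by rewrite /phi; lra.
have pos (c : R) : -1 < c -> 0 <= c * x -> 0 <= c ^+ 3 / (1 + c) * x.
  move=> c1 cx; have -> : c ^+ 3 / (1 + c) * x = (c ^+ 2 / (1 + c)) * (c * x) by ring.
  by rewrite mulr_ge0// divr_ge0 ?sqr_ge0//; lra.
have [x0|x0] := leP 0 x.
  have [||c] := @MVT_segment R phi (fun t => t ^+ 3 / (1 + t)) 0 x x0.
  - by move=> c; rewrite in_itv/= => /andP[c0 _]; apply: dphi; lra.
  - apply: continuous_in_subspaceT => c; rewrite inE/= in_itv/= => /andP[c0 _].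
    by apply: cphi; lra.
  - rewrite in_itv/= => /andP[c0 _]; rewrite phi0 !subr0 => ->.
    by apply: pos; [lra|exact: mulr_ge0].
have [||c] := @MVT_segment R phi (fun t => t ^+ 3 / (1 + t)) x 0 (ltW x0).
- by move=> c; rewrite in_itv/= => /andP[c0 _]; apply: dphi; lra.
- apply: continuous_in_subspaceT => c; rewrite inE/= in_itv/= => /andP[c0 _].
  by apply: cphi; lra.
- rewrite in_itv/= => /andP[c1 c0]; rewrite phi0 sub0r.
  have := @pos c; rewrite mulr_le0 ?(ltW x0)// => /(_ _ isT) H.
  by rewrite sub0r mulrN => /oppr_inj ->; apply: H; lra.
Qed.

(** The quadratic part has trace 0, as ln |p|^2 is harmonic; the cubic remainder
    will be absorbed by a strictly superharmonic term. *)
Lemma ln_sqnorm_le (p1 p2 : R) : 0 < p1 ^+ 2 + p2 ^+ 2 ->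
  exists2 E : R, 0 <= E & exists2 r1 : R, 0 < r1 & forall w1 w2 r : R,
    0 < r -> r <= r1 -> w1 ^+ 2 + w2 ^+ 2 = r ^+ 2 ->
    let N := p1 ^+ 2 + p2 ^+ 2 in
    ln ((p1 + w1) ^+ 2 + (p2 + w2) ^+ 2) <= ln N
       + (2 * p1 / N * w1 + 2 * p2 / N * w2)
       + ((N^-1 - 2 * p1 ^+ 2 / N ^+ 2) * w1 ^+ 2
         + (- 4 * p1 * p2 / N ^+ 2) * (w1 * w2)
         + (N^-1 - 2 * p2 ^+ 2 / N ^+ 2) * w2 ^+ 2) + E * r ^+ 3.
Proof.
set N := p1 ^+ 2 + p2 ^+ 2 => N0.
pose m : R := `|p1| + `|p2|.
have m0 : 0 <= m by rewrite addr_ge0.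
pose L : R := (2 * m + 1) / N.
have L0 : 0 < L by rewrite divr_gt0//; lra.
exists (2 * m / N ^+ 2 + L ^+ 3).
  apply: addr_ge0; last exact: exprn_ge0 (ltW L0).
  by apply: divr_ge0; [exact: mulr_ge0|exact: sqr_ge0].
exists (Num.min 1 (1 / (2 * L))); first by rewrite lt_min ltr01 divr_gt0// mulr_gt0.
move=> w1 w2 r r0; rewrite le_min => /andP[r1 rL] w /=.
have [w1r w2r] := le_radius (ltW r0) w.
pose s : R := p1 * w1 + p2 * w2.
have sm : `|s| <= m * r.
  rewrite (le_trans (ler_normD _ _))// !normrM /m mulrDl.
  by rewrite lerD// ler_wpM2l.
pose x : R := (2 * s + r ^+ 2) / N.
have xL : `|x| <= L * r.
  rewrite /x normrM (gtr0_norm (x := N^-1)) ?invr_gt0// /L mulrAC ler_wpM2r ?invr_ge0 ?(ltW N0)//.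
  rewrite (le_trans (ler_normD _ _))// normrM (ger0_norm (x := 2))// (ger0_norm (x := r ^+ 2)) ?sqr_ge0//.
  by move: sm; nra.
have xh : `|x| <= 1 / 2.
  apply: le_trans xL _; have L2 : 0 < 2 * L by lra.
  have := rL; rewrite (ler_pdivlMr _ _ L2); clearbody L; lra.
have x1 : -1 < x by move: xh; rewrite ler_norml => /andP[? _]; lra.
have -> : (p1 + w1) ^+ 2 + (p2 + w2) ^+ 2 = N * (1 + x).
  rewrite mulrDr mulr1 /x mulrC divfK ?gt_eqF// /s -w /N; ring.
rewrite lnM ?posrE//; last by lra.
have xq : - (x ^+ 2 / 2) <= - (2 * s ^+ 2 / N ^+ 2) + 2 * m / N ^+ 2 * r ^+ 3.
  have -> : x ^+ 2 / 2 = (2 * s ^+ 2 + 2 * s * r ^+ 2 + r ^+ 4 / 2) / N ^+ 2.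
    by rewrite /x; field; rewrite gt_eqF.
  have -> : - (2 * s ^+ 2 / N ^+ 2) + 2 * m / N ^+ 2 * r ^+ 3
    = (- 2 * s ^+ 2 + 2 * m * r ^+ 3) / N ^+ 2 by field; rewrite gt_eqF.
  rewrite -mulNr ler_wpM2r ?invr_ge0 ?sqr_ge0//.
  have : 0 <= r ^+ 4 by rewrite exprn_ge0// ltW.
  move: sm; rewrite ler_norml => /andP[sm _].
  have : - (s * r ^+ 2) <= m * r ^+ 3.
    have -> : m * r ^+ 3 = (m * r) * r ^+ 2 by ring.
    by rewrite -mulNr; apply: ler_wpM2r; [exact: sqr_ge0|lra].
  lra.
have x3 : x ^+ 3 / 3 <= L ^+ 3 * r ^+ 3.
  rewrite -exprMn; apply: (@le_trans _ _ (`|x| ^+ 3)).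
    rewrite -normrX; have := normr_ge0 (x ^+ 3); have := ler_norm (x ^+ 3); lra.
  by apply: lerXn2r => //; rewrite nnegrE// mulr_ge0 ?ltW.
have := ln1D_le x1.
have e : 2 * p1 / N * w1 + 2 * p2 / N * w2 + ((N^-1 - 2 * p1 ^+ 2 / N ^+ 2) * w1 ^+ 2
  + - 4 * p1 * p2 / N ^+ 2 * (w1 * w2) + (N^-1 - 2 * p2 ^+ 2 / N ^+ 2) * w2 ^+ 2)
  = x - 2 * s ^+ 2 / N ^+ 2.
  by rewrite /x -w /s; field; rewrite gt_eqF.
move: e xq x3; set A := 2 * p1 / N * w1 + _; set B := _ + _ * w2 ^+ 2.
clearbody A B; move: (s ^+ 2) => S2; clearbody x m L N; lra.
Qed.

Lemma continuous_sqnorm : continuous (fun p : R * R => p.1 ^+ 2 + p.2 ^+ 2).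
Proof.
move=> p.
have c1 : {for p, continuous (fun p : R * R => p.1)} by exact: cvg_fst.
have c2 : {for p, continuous (fun p : R * R => p.2)} by exact: cvg_snd.
by apply: cvgD; rewrite /GRing.exp /=; apply: cvgM.
Qed.

Lemma compact_annulus (a b : R) :
  compact [set p : R * R | a <= p.1 ^+ 2 + p.2 ^+ 2 <= b].
Proof.
pose B : set (R * R) := `[- (1 + `|b|), 1 + `|b|]%classic `*` `[- (1 + `|b|), 1 + `|b|]%classic.
have cB : compact B by apply: compact_setX; exact: segment_compact.
apply: (subclosed_compact _ cB) => [|[x y] /= /andP[_ xyb]].
  have -> : [set p : R * R | a <= p.1 ^+ 2 + p.2 ^+ 2 <= b]
      = (fun p : R * R => p.1 ^+ 2 + p.2 ^+ 2) @^-1` `[a, b]%classic.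
    by apply/seteqP; split=> p /=; rewrite in_itv.
  apply: closed_comp; last exact: interval_closed.
  by move=> p _; exact: continuous_sqnorm.
have bb := ler_norm b; have b0 := normr_ge0 b.
split => /=; rewrite in_itv /= -ler_norml.
  by rewrite -(@ler_pXn2r _ 2) ?nnegrE//= ?addr_ge0// real_normK ?num_real//; nra.
by rewrite -(@ler_pXn2r _ 2) ?nnegrE//= ?addr_ge0// real_normK ?num_real//; nra.
Qed.

(** The barrier is S + ln (|l|^2 / r^2) + tau (P - |l|^2) on the annulus
    r^2 <= |l|^2 <= P.  Its logarithm grows twice as fast as f is allowed to, so it
    dominates f on the outer circle once P is large; the term in tau makes it
    strictly superharmonic, and tau tends to 0 at the end. *)
Lemma log_estimate (f : R[i] -> \bar R) (S c0 r : R) : subharmonic f -> 0 < r ->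
  (forall x y : R, x ^+ 2 + y ^+ 2 <= r ^+ 2 -> (f (x +i* y)%C <= S%:E)%E) ->
  (forall x y : R, 1 <= x ^+ 2 + y ^+ 2 ->
     (f (x +i* y)%C <= (c0 + ln (x ^+ 2 + y ^+ 2) / 2)%:E)%E) ->
  forall x y : R, r ^+ 2 <= x ^+ 2 + y ^+ 2 ->
    (f (x +i* y)%C <= (S + ln ((x ^+ 2 + y ^+ 2) / r ^+ 2))%:E)%E.
Proof.
move=> sf r0 fS fL x0 y0 xyr.
have r2 : 0 < r ^+ 2 by rewrite exprn_gt0.
pose B : R := `|2 * (c0 - S + ln (r ^+ 2))| + (x0 ^+ 2 + y0 ^+ 2) + r ^+ 2.
pose P : R := expR B.
have B0 : 0 <= x0 ^+ 2 + y0 ^+ 2 by rewrite addr_ge0 ?sqr_ge0.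
have Bn := normr_ge0 (2 * (c0 - S + ln (r ^+ 2))).
have Bl := ler_norm (2 * (c0 - S + ln (r ^+ 2))).
have [BE1 BE2 BE3] : [/\ 0 <= B, 2 * (c0 - S + ln (r ^+ 2)) <= B & x0 ^+ 2 + y0 ^+ 2 <= B].
  by rewrite /B; split; lra.
have PB : 1 + B <= P by exact: expR_ge1Dx.
have lnP : ln P = B by rewrite expRK.
suff main (tau : R) : 0 < tau ->
    (f (x0 +i* y0)%C <= (S + ln ((x0 ^+ 2 + y0 ^+ 2) / r ^+ 2) + tau * P)%:E)%E.
  apply/lee_addgt0Pr => e e0; have P0 : 0 < P by exact: expR_gt0.
  have := main (e / P); rewrite divr_gt0// => /(_ isT).
  by rewrite divfK ?gt_eqF// EFinD.
move=> tau0.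
pose K := [set p : R * R | r ^+ 2 <= p.1 ^+ 2 + p.2 ^+ 2 <= P].
pose q (p : R * R) : R := p.1 ^+ 2 + p.2 ^+ 2.
(* the maximum only serves to make h continuous on the whole plane *)
pose h (p : R * R) : R := S + ln (Num.max (r ^+ 2) (q p) / r ^+ 2) + tau * (P - q p).
have ch : continuous h.
  move=> p; rewrite /h.
  have cq : {for p, continuous q} by exact: continuous_sqnorm.
  apply: cvgD.
    apply: cvgD; first exact: cvg_cst.
    apply: (continuous_comp (f := fun p => Num.max (r ^+ 2) (q p) / r ^+ 2) (g := @ln R)).
      apply: cvgM; last exact: cvg_cst.
      apply: (continuous_comp (f := q) (g := fun t => Num.max (r ^+ 2) t)) => //.
      by apply: continuous_max => ?; [exact: cvg_cst|exact: cvg_id].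
    by apply: continuous_ln; rewrite divr_gt0// lt_max r2.
  by apply: cvgM; [exact: cvg_cst|apply: cvgB; [exact: cvg_cst|exact: cq]].
have Kxy : K (x0, y0) by rewrite /K /= xyr /=; lra.
have := @subharmonic_le _ f K h sf (@compact_annulus _ _) ch _ (x0, y0) Kxy.
move=> H; apply: le_trans (H _) _; last first.
  rewrite lee_fin /h /q /= (max_idPr xyr) lerD2l ler_wpM2l ?(ltW tau0)//; lra.
move=> p /andP[rp pP].
have qp : Num.max (r ^+ 2) (q p) = q p by exact/max_idPr.
have hp : h p = S + ln (q p / r ^+ 2) + tau * (P - q p) by rewrite /h qp.
have [rq|rq] := eqVneq (q p) (r ^+ 2).
  left; apply: le_trans (fS _ _ _) _; first by rewrite -rq.
  rewrite hp lee_fin rq divff ?gt_eqF// ln1 addr0 lerDl mulr_ge0 ?(ltW tau0)// -rq; rewrite /q; lra.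
have q0 : 0 < q p by apply: lt_le_trans rp.
have lnq (t : R) : 0 < t -> ln (t / r ^+ 2) = ln t - ln (r ^+ 2) by move=> t0; rewrite ln_div ?posrE.
have [Pq|Pq] := eqVneq (q p) P.
  left; apply: le_trans (fL _ _ _) _; first by rewrite -/(q p) Pq; apply: le_trans PB; rewrite lerDl.
  rewrite hp lee_fin lnq// -/(q p) Pq subrr mulr0 addr0 lnP; lra.
have rq' : r ^+ 2 < q p by rewrite lt_neqAle eq_sym rq.
have Pq' : q p < P by rewrite lt_neqAle Pq.
right; have [E E0 [r1 r10 lnle]] := ln_sqnorm_le q0.
(* a radius keeping the circle in the annulus, and the cubic remainder below
   half of the gain tau |w|^2 *)
pose m : R := 2 * (`|p.1| + `|p.2|) + 1.
have m1 : 1 <= m by rewrite /m lerDr mulr_ge0.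
pose d : R := Num.min (q p - r ^+ 2) (P - q p).
have d0 : 0 < d by rewrite lt_min !subr_gt0 rq' Pq'.
pose rho : R := Num.min (Num.min 1 r1) (Num.min (d / m) (tau / (2 * (E + 1)))).
have E1 : 0 < 2 * (E + 1) by lra.
have m0 : 0 < m by lra.
have rho0 : 0 < rho by rewrite !lt_min ltr01 r10 !divr_gt0.
have [h1 h2 h3 h4] : [/\ rho <= 1, rho <= r1, rho <= d / m & rho <= tau / (2 * (E + 1))].
  by rewrite /rho !ge_min !lexx !orbT.
move: h3 h4; rewrite !ler_pdivlMr// => h3 h4.
have hEr : E * rho ^+ 3 <= tau / 2 * rho ^+ 2.
  have -> : E * rho ^+ 3 = (E * rho) * rho ^+ 2 by ring.
  by apply: ler_wpM2r; [exact: sqr_ge0|nra].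
exists rho, (2 * p.1 / q p - tau * (2 * p.1)), (2 * p.2 / q p - tau * (2 * p.2)),
  ((q p)^-1 - 2 * p.1 ^+ 2 / q p ^+ 2 - tau / 2), (- 4 * p.1 * p.2 / q p ^+ 2),
  ((q p)^-1 - 2 * p.2 ^+ 2 / q p ^+ 2 - tau / 2); split => //.
  have -> : (q p)^-1 - 2 * p.1 ^+ 2 / q p ^+ 2 - tau / 2
    + ((q p)^-1 - 2 * p.2 ^+ 2 / q p ^+ 2 - tau / 2) = - tau.
    by rewrite /q; field; rewrite gt_eqF.
  by rewrite oppr_lt0.
move=> w1 w2 w; have [w1r w2r] := le_radius (ltW rho0) w.
have qw : q (p.1 + w1, p.2 + w2) = q p + 2 * (p.1 * w1 + p.2 * w2) + rho ^+ 2.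
  by rewrite -w /q /=; ring.
have sm : `|2 * (p.1 * w1 + p.2 * w2) + rho ^+ 2| <= d.
  apply: le_trans h3; rewrite (le_trans (ler_normD _ _))// normrM (ger0_norm (x := 2))//.
  rewrite (ger0_norm (x := rho ^+ 2)) ?sqr_ge0//.
  have : `|p.1 * w1 + p.2 * w2| <= (`|p.1| + `|p.2|) * rho.
    by rewrite (le_trans (ler_normD _ _))// !normrM mulrDl lerD// ler_wpM2l.
  by rewrite /m; nra.
move: (sm); rewrite /d le_min !ler_norml => /andP[/andP[s1 s2] /andP[s3 s4]].
have Kw : K (p.1 + w1, p.2 + w2) by rewrite /K /= -[_ + _]/(q (_, _)) qw; apply/andP; split; lra.
split => //.
have qw0 : r ^+ 2 <= q (p.1 + w1, p.2 + w2) by rewrite qw; lra.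
rewrite hp /h (max_idPr qw0) !lnq//; last exact: lt_le_trans qw0.
have := lnle w1 w2 rho rho0 h2 w; rewrite -/(q p) /=.
rewrite -[_ ^+ 2 + _ ^+ 2]/(q (p.1 + w1, p.2 + w2)) qw.
move: w; set lg := ln (_ + _ + _); clearbody lg; move=> w hl.
have : rho ^+ 2 * (tau / 2) = w1 ^+ 2 * (tau / 2) + w2 ^+ 2 * (tau / 2) by rewrite -w; ring.
move: hl hEr; rewrite -w.
lra.
Qed.

End Barriers.
(** * Derivatives along lines, coordinates *)

Section Lines.
Variables (R : realType) (V W : normedModType R).
Implicit Types (y v : V) (t : R).

Lemma is_derive_line (f : V -> W) y v t : differentiable f (y + t *: v) ->
  is_derive t 1 (fun s => f (y + s *: v)) ('d f (y + t *: v) v).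
Proof.
move=> df; set a := y + t *: v.
have E : (fun h : R => h^-1 *: (((fun s => f (y + s *: v)) \o shift t) (h *: 1) - f (y + t *: v)))
  = (fun h => h^-1 *: ((f \o shift a) (h *: v) - f a)).
  apply/funext => h /=; rewrite /a; congr (_ *: (f _ - _)).
  by rewrite [h *: 1]mulr1 scalerDl addrCA addrC.
split; first by rewrite /derivable E; exact: diff_derivable.
by rewrite /derive E -[LHS]/('D_v f a) deriveE.
Qed.

Lemma is_derive_approx (g : R -> W) (d : W) (t e : R) : is_derive t 1 g d -> 0 < e ->
  \forall s \near 0, `|g (t + s) - g t - s *: d| <= e * `|s|.
Proof.
move=> [dg dE] e0.
have : h^-1 *: (g (h + t) - g t) @[h --> 0^'] --> d.
  rewrite -dE /derive; move: dg; rewrite /derivable.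
  have -> : (fun h : R => h^-1 *: ((g \o shift t) (h *: 1) - g t))
    = (fun h => h^-1 *: (g (h + t) - g t)).
    by apply/funext => h /=; rewrite [h *: 1]mulr1.
  by [].
move=> /cvgr_dist_le/(_ e e0); rewrite near_withinE => H.
near=> s; have [->|s0] := eqVneq s 0.
  by rewrite addr0 subrr scale0r subr0 !normr0 mulr0.
have : `|d - s^-1 *: (g (s + t) - g t)| <= e by move: s0; near: s.
move=> /(ler_wpM2l (normr_ge0 s)); rewrite -normrZ scalerBr scalerA divff// scale1r.
by rewrite distrC (addrC t) mulrC.
Unshelve. all: by end_near. Qed.

End Lines.

Section Segments.
Variables (R : realType) (V : normedModType R).

Lemma segment_MVT (f : V -> R) (y v : V) :
  (forall t : R, 0 <= t -> t <= 1 -> differentiable f (y + t *: v)) ->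
  exists t : R, [/\ 0 <= t, t <= 1 & f (y + v) - f y = 'd f (y + t *: v) v].
Proof.
move=> df; pose g s := f (y + s *: v).
have dg (t : R) : 0 <= t -> t <= 1 -> is_derive t 1 g ('d f (y + t *: v) v).
  by move=> t0 t1; apply: is_derive_line; exact: df.
have [||t] := @MVT_segment R g (fun t => 'd f (y + t *: v) v) 0 1 ler01.
- by move=> t; rewrite in_itv /= => /andP[/ltW t0 /ltW t1]; exact: dg.
- apply: continuous_in_subspaceT => t; rewrite inE /= in_itv /= => /andP[t0 t1].
  have d := dg t t0 t1.
  by apply/differentiable_continuous/derivable1_diffP.
rewrite in_itv /= => /andP[t0 t1]; rewrite /g scale1r scale0r addr0 subr0 mulr1 => e.
by exists t.
Qed.

End Segments.

Section Coordinates.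
Variables (R : realType) (n : nat).
Implicit Types z v : Cn R n.

(** The 2n real coordinates of x + iy, x first. *)
Definition coord (z : Cn R n) : 'rV[R]_(n + n) := row_mx z.1 z.2.
Definition ebase (l : 'I_(n + n)) : Cn R n :=
  (lsubmx (delta_mx 0 l), rsubmx (delta_mx 0 l)).

Lemma coordE z : z = \sum_l coord z 0 l *: ebase l.
Proof.
have -> : z = (lsubmx (coord z), rsubmx (coord z)).
  by rewrite /coord row_mxKl row_mxKr; case: z.
set c := coord _; rewrite [in LHS](row_sum_delta c).
have -> : coord (lsubmx c, rsubmx c) = c by rewrite /coord hsubmxK.
rewrite !linear_sum /=.
elim/big_ind3 : _ => //=.
- by move=> ? x2 x3 ? y2 y3 <- <-.
- by move=> i _; rewrite !linearZ.
Qed.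

Lemma norm_le_prod (x y : 'rV[R]_n) (a : R) :
  `|((x, y) : Cn R n)| <= a <-> `|x| <= a /\ `|y| <= a.
Proof.
by rewrite prod_normE /= ge_max; split => [/andP|]; last by move/andP.
Qed.

Lemma norm_le_coord z (a : R) : 0 <= a -> `|z| <= a <-> forall l, `|coord z 0 l| <= a.
Proof.
move=> a0; case: z => x y; rewrite norm_le_prod.
have rvP (u : 'rV[R]_n) : `|u| <= a <-> forall j, `|u 0 j| <= a.
  rewrite /Num.norm /= mx_normrE; split => [|H].
    by move=> /bigmax_leP[_ H] j; exact: (H (0, j)).
  by apply/bigmax_leP; split => // -[i j] _; rewrite (ord1 i); exact: H.
rewrite !rvP /coord /=; split => [[hx hy] l|h].
  by rewrite mxE; case: splitP => j _.
by split => j; [have := h (lshift n j)|have := h (rshift n j)]; rewrite ?row_mxEl ?row_mxEr.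
Qed.

Lemma coord_le z l : `|coord z 0 l| <= `|z|.
Proof. exact: (iffLR (norm_le_coord z (normr_ge0 z))). Qed.

Lemma norm_J z : `|J z| = `|z|.
Proof. by case: z => x y; rewrite !prod_normE /= normrN maxC. Qed.

Lemma J_D z v : J (z + v) = J z + J v.
Proof. by rewrite /J /= opprD. Qed.

Lemma J_Z (a : R) z : J (a *: z) = a *: J z.
Proof. by rewrite /J /= -scalerN. Qed.

Lemma compact_ball_Cn (x : Cn R n) (r : R) : compact [set z : Cn R n | `|z - x| <= r].
Proof.
have cr (a : 'rV[R]_n) : compact [set u : 'rV[R]_n | `|u - a| <= r].
  apply: bounded_closed_compact.
    exists (r + `|a|); split; first exact: num_real.
    move=> N /ltW rN u /= ur; apply: le_trans rN.
    by rewrite -[u](subrK a) (le_trans (ler_normD _ _))// lerD2r.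
  have -> : [set u : 'rV[R]_n | `|u - a| <= r] = closed_ball_ Num.norm a r.
    by apply/seteqP; split=> u /=; rewrite /closed_ball_ /= distrC.
  exact: closed_closed_ball_.
have -> : [set z : Cn R n | `|z - x| <= r] =
   [set u | `|u - x.1| <= r] `*` [set u | `|u - x.2| <= r].
  apply/seteqP; split => -[u v] /=; first by move/norm_le_prod.
  by move=> h; apply/norm_le_prod.
exact: compact_setX.
Qed.

End Coordinates.
(** * Distance to a zero set *)

Section Lyusternik.
Variables (R : realType) (n k : nat).

(** Minimise 4 W (sum of |F i y|) + |y - x| over the closed ball.  If F y were
    nonzero at a minimum y, moving in the direction - sum (F j y) w_j would
    decrease the sum at least at 3/8 of its value per unit of time, because
    the w_j are almost dual to the derivatives G i y, while the distance to x grows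
    at most at W times that value: the weight 4 W makes the total decrease.  The
    bound on F x keeps the minimum inside the ball. *)
Lemma lyusternik (F : 'I_k -> Cn R n -> R) (G : 'I_k -> Cn R n -> Cn R n -> R)
    (w : 'I_k -> Cn R n) (x : Cn R n) (r W : R) :
  0 < r -> 0 < W -> (forall j, `|w j| <= W) ->
  (forall i y, `|y - x| <= r -> {for y, continuous (F i)}) ->
  (forall i y v, `|y - x| <= r -> is_derive (0 : R) (1 : R) (fun t : R => F i (y + t *: v)) (G i y v)) ->
  (forall i y (c : 'I_k -> R), G i y (\sum_j c j *: w j) = \sum_j c j * G i y (w j)) ->
  (forall i j y, `|y - x| <= r -> k%:R * `|G i y (w j) - (i == j)%:R| <= 1 / 2) ->
  4 * W * (\sum_i `|F i x|) < r ->
  exists y, (forall i, F i y = 0) /\ `|y - x| <= 4 * W * (\sum_i `|F i x|).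
Proof.
move=> r0 W0 wW cF dF lG Gd xr.
pose phi y : R := \sum_i `|F i y|.
have phi0 y : 0 <= phi y by rewrite sumr_ge0.
pose psi y : R := 4 * W * phi y + `|y - x|.
pose B := [set y : Cn R n | `|y - x| <= r].
have Bx : B x by rewrite /B /= subrr normr0 ltW.
have cpsi : {within B, continuous psi}.
  apply: continuous_in_subspaceT => y; rewrite inE => By.
  rewrite /psi; apply: cvgD; last first.
    by apply: (@cvg_norm _ (Cn R n)); apply: cvgB; [exact: cvg_id|exact: cvg_cst].
  apply: cvgM; first exact: cvg_cst.
  rewrite /phi; apply: cvg_big => [|i _]; first exact: add_continuous.
  by apply: cvg_norm; exact: cF.
have [y] := compact_EVT_min (ex_intro _ x Bx) (@compact_ball_Cn R n x r) cpsi.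
rewrite inE => By ymin.
have yx : psi y <= psi x by apply: ymin; rewrite inE.
have psix : psi x = 4 * W * phi x by rewrite /psi subrr normr0 addr0.
have yxW : `|y - x| <= 4 * W * phi x.
  by rewrite -psix (le_trans _ yx)// lerDr !mulr_ge0// ltW.
suff phiy : phi y = 0.
  exists y; split=> // i; apply/eqP; rewrite -normr_eq0; apply/eqP.
  by move/eqP: phiy; rewrite psumr_eq0// => /allP/(_ i)/(_ (mem_index_enum _))/eqP.
apply/eqP; rewrite eq_le phi0 andbT leNgt; apply/negP => phip.
set Phi := phi y in phip.
pose v : Cn R n := \sum_j (- F j y) *: w j.
have vW : `|v| <= Phi * W.
  rewrite (le_trans (ler_norm_sum _ _ _))// /Phi /phi mulr_suml ler_sum// => j _.
  by rewrite normrZ normrN ler_wpM2l.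
have k0 : (0 < k)%N.
  rewrite lt0n; apply/eqP => k0; move: phip; rewrite /Phi /phi.
  by rewrite big1 ?ltxx// => i _; have := leq_trans (ltn_ord i) (eq_leq k0).
have kR : 0 < k%:R :> R by rewrite ltr0n.
have Gv i : `|G i y v + F i y| <= Phi / (2 * k%:R).
  rewrite /v lG.
  have -> : \sum_j - F j y * G i y (w j) + F i y = \sum_j - F j y * (G i y (w j) - (i == j)%:R).
    under [in RHS]eq_bigr do rewrite mulrBr.
    rewrite sumrB; congr (_ + _); rewrite (bigD1 i)//= eqxx mulr1 big1 ?addr0 ?opprK// => j.
    by rewrite eq_sym => /negbTE ->; rewrite mulr0.
  rewrite (le_trans (ler_norm_sum _ _ _))// /Phi /phi mulr_suml ler_sum// => j _.
  rewrite normrM normrN ler_wpM2l// -[leRHS]mul1r ler_pdivlMr ?mulr_gt0//.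
  by have := Gd i j y By; lra.
pose e : R := Phi / (8 * k%:R).
have e0 : 0 < e by rewrite divr_gt0// mulr_gt0.
have small : \forall t \near (0 : R), forall i, `|F i (y + t *: v) - F i y - t * G i y v| <= e * `|t|.
  pose P (i : 'I_k) (t : R) := `|F i (y + t *: v) - F i y - t * G i y v| <= e * `|t|.
  apply: (@filter_forall R _ P (nbhs (0 : R)) _) => i.
  have := is_derive_approx (dF i y v By) e0; apply: filterS => t.
  by rewrite /P add0r scale0r addr0.
have rY : 0 < (r - `|y - x|) / (Phi * W) by rewrite divr_gt0 ?mulr_gt0// subr_gt0 (le_lt_trans yxW).
have [t [t0 t1 tr ts]] : exists t : R, [/\ 0 < t, t <= 1, t <= (r - `|y - x|) / (Phi * W) &
   forall i, `|F i (y + t *: v) - F i y - t * G i y v| <= e * `|t|].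
  move: small => -[d /= d0 dP].
  pose t : R := Num.min (Num.min 1 (d / 2)) ((r - `|y - x|) / (Phi * W)).
  have t0 : 0 < t by rewrite !lt_min ltr01 rY divr_gt0.
  have [h1 h2 h3] : [/\ t <= 1, t <= d / 2 & t <= (r - `|y - x|) / (Phi * W)].
    by rewrite /t !ge_min !lexx !orbT.
  exists t; split => //; apply: dP => /=.
  by rewrite sub0r normrN gtr0_norm//; lra.
have tv : `|t *: v| <= t * (Phi * W) by rewrite normrZ gtr0_norm// ler_wpM2l// ltW.
have By' : B (y + t *: v).
  move: tr; rewrite ler_pdivlMr ?mulr_gt0// => tr.
  by rewrite /B /= addrAC (le_trans (ler_normD _ _))//; lra.
have := ymin _ (mem_set By').
suff : phi (y + t *: v) <= Phi - 3 / 8 * t * Phi.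
  move=> h; rewrite leNgt => /negP; apply.
  rewrite /psi -/Phi.
  have h2 : `|y + t *: v - x| <= `|y - x| + t * (Phi * W).
    by rewrite addrAC (le_trans (ler_normD _ _))// lerD2l.
  have : 4 * W * phi (y + t *: v) <= 4 * W * (Phi - 3 / 8 * t * Phi).
    by rewrite ler_wpM2l// mulr_ge0// ltW.
  have : 0 < t * (Phi * W) by rewrite !mulr_gt0.
  nra.
have step i : `|F i (y + t *: v)| <= (1 - t) * `|F i y| + t * (Phi / (2 * k%:R)) + e * t.
  have -> : F i (y + t *: v) = (1 - t) * F i y + t * (G i y v + F i y)
     + (F i (y + t *: v) - F i y - t * G i y v) by ring.
  rewrite (le_trans (ler_normD _ _))// lerD//; last by have := ts i; rewrite (gtr0_norm t0).
  rewrite (le_trans (ler_normD _ _))// lerD//.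
    by rewrite normrM ger0_norm// subr_ge0.
  by rewrite normrM gtr0_norm// ler_wpM2l// ltW.
rewrite (@le_trans _ _ (\sum_(i < k) ((1 - t) * `|F i y| + (t * (Phi / (2 * k%:R)) + e * t))))//.
  by apply: ler_sum => i _; rewrite addrA.
rewrite big_split /= -mulr_sumr -/(phi y) -/Phi sumr_const card_ord -[_ *+ k]mulr_natr.
rewrite le_eqVlt; apply/orP; left; apply/eqP; rewrite /e; field.
by rewrite gt_eqF.
Qed.

End Lyusternik.
(** * Functions of class C^2 near a point *)

Section LocalGeometry.
Variables (R : realType) (n : nat).
Implicit Types (p y z v : Cn R n) (f : Cn R n -> R).

(** Differentials are handled as plain functions satisfying this equation, so that
    those taken at different points can be compared. *)
Definition linear_form (L : Cn R n -> R) :=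
  forall (a : R) u v, L (a *: u + v) = a * L u + L v.

Lemma diff_linear f y : linear_form ('d f y).
Proof. by move=> a u v; rewrite linearP. Qed.

Lemma linear_coord L v : linear_form L ->
  L v = \sum_l coord v 0 l * L (@ebase R n l).
Proof.
move=> linL; have L0 : L 0 = 0.
  by have := linL (-1) 0 0; rewrite scaler0 addr0 mulN1r addNr.
rewrite {1}(coordE v).
apply: (big_ind2 (fun u (s : R) => L u = s)) => //.
- by move=> u s u' s' <- <-; have := linL 1 u u'; rewrite scale1r mul1r.
- by move=> l _; have := linL (coord v 0 l) (@ebase R n l) 0; rewrite L0 !addr0.
Qed.

Lemma linear_sum_form (I : finType) L (c : I -> R) (w : I -> Cn R n) : linear_form L ->
  L (\sum_i c i *: w i) = \sum_i c i * L (w i).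
Proof.
move=> linL; have L0 : L 0 = 0.
  by have := linL (-1) 0 0; rewrite scaler0 addr0 mulN1r addNr.
apply: (big_ind2 (fun u (s : R) => L u = s)) => //.
- by move=> u s u' s' <- <-; have := linL 1 u u'; rewrite scale1r mul1r.
- by move=> l _; have := linL (c l) (w l) 0; rewrite L0 !addr0.
Qed.

Lemma linear_sub_bound L1 L2 (A : 'I_(n + n) -> R) v : linear_form L1 -> linear_form L2 ->
  (forall l, `|L1 (@ebase R n l) - L2 (@ebase R n l)| <= A l) ->
  `|L1 v - L2 v| <= (\sum_l A l) * `|v|.
Proof.
move=> lin1 lin2 LA; rewrite (linear_coord v lin1) (linear_coord v lin2).
rewrite -sumrB (le_trans (ler_norm_sum _ _ _))//.
rewrite mulr_suml ler_sum// => l _; rewrite -mulrBr normrM mulrC.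
by rewrite ler_pM// coord_le.
Qed.

Lemma near_closed_ball p (P : Cn R n -> Prop) : (\forall y \near p, P y) ->
  exists2 r : R, 0 < r & forall y, `|y - p| <= r -> P y.
Proof.
move=> /nbhs_normP[r /= r0 rP]; exists (r / 2); first by rewrite divr_gt0.
by move=> y yr; apply: rP => /=; rewrite distrC; lra.
Qed.

Lemma closed_ball_near p (r : R) : 0 < r -> \forall z \near p, `|z - p| <= r.
Proof.
by move=> r0; apply/nbhs_normP; exists r => //= z; rewrite distrC => /ltW.
Qed.

Lemma convex_ball p y z (r t : R) : `|y - p| <= r -> `|z - p| <= r -> 0 <= t -> t <= 1 ->
  `|z + t *: (y - z) - p| <= r.
Proof.
move=> yr zr t0 t1.
have -> : z + t *: (y - z) - p = (1 - t) *: (z - p) + t *: (y - p).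
  have -> : y - z = (y - p) - (z - p) by rewrite opprB addrA subrK.
  rewrite addrAC; move: (z - p) (y - p) => a b.
  by rewrite scalerBl scale1r scalerBr addrA addrAC.
rewrite (le_trans (ler_normD _ _))// !normrZ !ger0_norm ?subr_ge0//.
have := ler_wpM2l t0 yr; have : (1 - t) * `|z - p| <= (1 - t) * r by rewrite ler_wpM2l ?subr_ge0.
lra.
Qed.

(** Near p the second derivatives in all coordinate directions are bounded, by
    continuity at p; the mean value theorem on segments turns this into a Lipschitz
    bound for the differential. *)
Lemma C2_lipschitz (U : set (Cn R n)) f p : open U -> U p -> C2_on U f ->
  exists2 r : R, 0 < r & exists2 C : R, 0 <= C &
    forall y, `|y - p| <= r -> [/\ U y, differentiable f y &
    forall z v, `|z - p| <= r -> `|'d f y v - 'd f z v| <= C * `|y - z| * `|v|].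
Proof.
move=> oU Up [c1 c2].
pose g (l : 'I_(n + n)) y := 'd f y (@ebase R n l).
pose A l k : R := `|'d (g l) p (@ebase R n k)| + 1.
have [r r0 rP] : exists2 r : R, 0 < r & forall y, `|y - p| <= r ->
    U y /\ forall l k, `|'d (g l) y (@ebase R n k)| <= A l k.
  apply: near_closed_ball; apply: filterI; first exact: open_nbhs_nbhs.
  apply: (@filter_forall _ _ (fun l y => forall k, `|'d (g l) y (@ebase R n k)| <= A l k) (nbhs p) _) => l.
  apply: (@filter_forall _ _ (fun k y => `|'d (g l) y (@ebase R n k)| <= A l k) (nbhs p) _) => k.
  have [_ /(_ (@ebase R n k)) cgl] := c2 (@ebase R n l) p Up.
  by apply: (cvgr_norm_le _ cgl); rewrite /A /g ltrDl.
exists r => //; exists (\sum_l \sum_k A l k).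
  by rewrite sumr_ge0// => l _; rewrite sumr_ge0// => k _; rewrite addr_ge0.
move=> y yr; have [Uy _] := rP y yr; have [df _] := c1 y Uy; split => // z v zr.
rewrite mulr_suml; apply: linear_sub_bound; [exact: diff_linear..|move=> l].
have [|t [t0 t1]] := @segment_MVT _ _ (g l) z (y - z).
  move=> t t0 t1; have [Ut _] := rP _ (convex_ball yr zr t0 t1).
  by have [] := c2 (@ebase R n l) _ Ut.
have -> : z + (y - z) = y by rewrite addrC subrK.
move=> e; suff : `|'d (g l) (z + t *: (y - z)) (y - z)| <= (\sum_k A l k) * `|y - z|.
  by move=> h; rewrite -[X in `|X|]/(g l y - g l z) e.
have := @linear_sub_bound ('d (g l) (z + t *: (y - z))) (fun=> 0) (A l) (y - z).
rewrite subr0; apply; first exact: diff_linear.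
  by move=> *; rewrite mulr0 addr0.
by move=> k; rewrite subr0; have [_] := rP _ (convex_ball yr zr t0 t1); apply.
Qed.

(** By the mean value theorem the increment of f is the differential at some point
    of the segment, which is within C |v| of the differential at y. *)
Lemma taylor_order2 f p (r C : R) :
  (forall y, `|y - p| <= r -> differentiable f y /\
    forall z v, `|z - p| <= r -> `|'d f y v - 'd f z v| <= C * `|y - z| * `|v|) ->
  forall y v, `|y - p| <= r -> `|y + v - p| <= r ->
    `|f (y + v) - f y - 'd f y v| <= C * `|v| ^+ 2.
Proof.
move=> H y v yr yvr.
have addK (a b : Cn R n) : a + b - a = b by rewrite addrAC subrr add0r.
have seg (t : R) : 0 <= t -> t <= 1 -> `|y + t *: v - p| <= r.
  by move=> t0 t1; have := convex_ball yvr yr t0 t1; rewrite addK.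
have [|t [t0 t1 ->]] := @segment_MVT _ _ f y v.
  by move=> t t0 t1; have [] := H _ (seg t t0 t1).
have [_ /(_ y v yr)] := H _ (seg t t0 t1); move=> /le_trans; apply.
rewrite addK normrZ (ger0_norm t0) expr2.
have C0 : 0 <= C * `|v| * `|v|.
  have [_ /(_ y v yr)] := H _ yvr; rewrite addK.
  by apply: le_trans.
have -> : C * (t * `|v|) * `|v| = t * (C * `|v| * `|v|) by ring.
by rewrite (mulrA C) ler_piMl.
Qed.

(** The matrix of the forms in the coordinate basis has independent rows, hence a
    right inverse, whose columns are the required vectors. *)
Lemma dual_basis k (L : 'I_k -> Cn R n -> R) : (forall j, linear_form (L j)) ->
  (forall c : 'I_k -> R, (forall v : Cn R n, \sum_j c j * L j v = 0) -> forall j, c j = 0) ->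
  exists w : 'I_k -> Cn R n, forall i j, L i (w j) = (i == j)%:R.
Proof.
move=> linL indep.
pose A : 'M[R]_(k, n + n) := \matrix_(j, l) L j (@ebase R n l).
have /row_freeP[B AB] : row_free A.
  apply: inj_row_free => c cA; apply/rowP => j; rewrite mxE.
  apply: (indep (fun j => c 0 j)) => v.
  under eq_bigr do rewrite (linear_coord v (linL _)) mulr_sumr.
  rewrite exchange_big big1//= => l _.
  have cl : \sum_j c 0 j * A j l = 0 by have /rowP/(_ l) := cA; rewrite !mxE.
  under eq_bigr do rewrite mulrCA.
  rewrite -mulr_sumr; transitivity (coord v 0 l * \sum_j c 0 j * A j l); last by rewrite cl mulr0.
  by congr (_ * _); apply: eq_bigr => i _; rewrite mxE.
exists (fun j => \sum_l B l j *: @ebase R n l) => i j.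
rewrite linear_sum_form//; have /matrixP/(_ i j) := AB; rewrite !mxE => <-.
by apply: eq_bigr => l _; rewrite mxE mulrC.
Qed.

(** The function f vanishes along a curve in M, so its derivative along the
    curve, which is 'd f p v, is 0. *)
Lemma tangent_kernel (M U : set (Cn R n)) f p v : open U -> U p ->
  (forall z, U z -> M z -> f z = 0) -> differentiable f p ->
  tangent_space M p v -> 'd f p v = 0.
Proof.
move=> oU Up Mf df [gamma [g0 Mg dg]].
have dgam : differentiable gamma 0 by apply/derivable1_diffP.
have dfg : differentiable (f \o gamma) 0 by apply: differentiable_comp; rewrite ?g0.
have vE : 'd gamma (0 : R) 1 = v by rewrite -deriveE// derive_val.
have d0 : is_derive (0 : R) 1 (f \o gamma) ('d f p v).
  split; first exact: diff_derivable.
  by rewrite deriveE// diff_comp ?g0//= vE.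
have Ug : \forall t \near (0 : R), U (gamma t).
  have cg : {for (0 : R), continuous gamma} by exact: differentiable_continuous.
  by apply: cg; rewrite g0; exact: open_nbhs_nbhs.
apply/eqP; rewrite -normr_le0; apply/ler_addgt0Pr => e e0; rewrite add0r.
have ap := is_derive_approx d0 e0.
have [t [t0 Mt Ut apt]] : exists t : R, [/\ 0 < t, M (gamma t), U (gamma t) &
    `|(f \o gamma) (0 + t) - (f \o gamma) 0 - t *: 'd f p v| <= e * `|t|].
  have : \forall t \near (0:R), [/\ M (gamma t), U (gamma t) &
    `|(f \o gamma) (0 + t) - (f \o gamma) 0 - t *: 'd f p v| <= e * `|t|] by near=> t; split; near: t.
  move=> [d /= d0' dP]; exists (d / 2).
  have [|? ? ?] := dP (d / 2).
    by rewrite /= sub0r normrN gtr0_norm; lra.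
  by split => //; lra.
move: apt; rewrite /= add0r g0 (Mf _ Ut Mt) (Mf p Up); last first.
  by have := nbhs_singleton Mg; rewrite g0.
rewrite subr0 sub0r normrN normrZ mulrC ler_pM2r// normr_gt0 gt_eqF//.
Unshelve. all: by end_near. Qed.

End LocalGeometry.
(** * Tangent real lines of a generic submanifold *)

Section UniformGeometry.
Variables (R : realType) (n : nat).
Implicit Types (p y z v h : Cn R n) (M : set (Cn R n)).

(** Defining functions rho of M in the ball of radius r about p0, with
    differentials D, in quantitative form: the same C is a Lipschitz constant of
    the differentials and the constant of the second order Taylor estimate, and
    the vectors w are dual to the differentials at p0. *)
Record local_equations M p0 k (rho : 'I_k -> Cn R n -> R) (D : 'I_k -> Cn R n -> Cn R n -> R)
    (w : 'I_k -> Cn R n) (r C : R) : Prop := LocalEquations {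
  eqs_radius : 0 < r;
  eqs_const : 0 <= C;
  eqs_zero : forall y, `|y - p0| <= r -> (M y <-> forall j, rho j y = 0);
  eqs_lin : forall j y, linear_form (D j y);
  eqs_cont : forall j y, `|y - p0| <= r -> {for y, continuous (rho j)};
  eqs_contD : forall j y, `|y - p0| <= r -> continuous (D j y);
  eqs_der : forall j y v, `|y - p0| <= r ->
    is_derive (0 : R) (1 : R) (fun t : R => rho j (y + t *: v)) (D j y v);
  eqs_lip : forall j y z v, `|y - p0| <= r -> `|z - p0| <= r ->
    `|D j y v - D j z v| <= C * `|y - z| * `|v|;
  eqs_taylor : forall j y v, `|y - p0| <= r -> `|y + v - p0| <= r ->
    `|rho j (y + v) - rho j y - D j y v| <= C * `|v| ^+ 2;
  eqs_dual : forall i j, D i p0 (w j) = (i == j)%:R;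
  eqs_tangent : forall j v, tangent_space M p0 v -> D j p0 v = 0 }.

Lemma local_equationsP m M p0 : C2_submanifold m M -> M p0 ->
  exists k rho D w r C, @local_equations M p0 k rho D w r C.
Proof.
move=> [_ /(_ p0)] H Mp; have [U [rho [oU Up rC2 Mrho indep]]] := H Mp.
pose D j y v := 'd (rho j) y v.
have [rU rU0 rUP] := near_closed_ball (open_nbhs_nbhs (conj oU Up)).
have /choice[rj /= rjP] : forall j, exists r : R, 0 < r /\ exists2 C : R, 0 <= C &
    forall y, `|y - p0| <= r -> [/\ U y, differentiable (rho j) y &
    forall z v, `|z - p0| <= r -> `|D j y v - D j z v| <= C * `|y - z| * `|v|].
  by move=> j; have [r r0 rP] := C2_lipschitz oU Up (rC2 j); exists r.
have /choice[Cj /= CjP] : forall j, exists C : R, 0 <= C /\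
    forall y, `|y - p0| <= rj j -> [/\ U y, differentiable (rho j) y &
    forall z v, `|z - p0| <= rj j -> `|D j y v - D j z v| <= C * `|y - z| * `|v|].
  by move=> j; have [_ [C C0 CP]] := rjP j; exists C.
pose r : R := \big[Order.min/rU]_j rj j.
have r0 : 0 < r by apply: lt_bigmin => // j _; have [] := rjP j.
have rle j : r <= rj j by exact: bigmin_le.
have rleU : r <= rU by exact: bigmin_le_id.
pose C : R := \sum_j Cj j.
have Cj0 j : 0 <= Cj j by have [] := CjP j.
have Cle j : Cj j <= C by rewrite /C (bigD1 j)//= lerDl sumr_ge0.
have main j y : `|y - p0| <= r -> [/\ U y, differentiable (rho j) y &
    forall z v, `|z - p0| <= r -> `|D j y v - D j z v| <= C * `|y - z| * `|v|].
  move=> yr; have [_ /(_ y (le_trans yr (rle j)))[Uy dy lip]] := CjP j; split => // z v zr.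
  apply: le_trans (lip z v (le_trans zr (rle j))) _.
  by do 2 apply: ler_wpM2r => //.
have [||w wP] := @dual_basis R n _ (fun j => D j p0).
- by move=> j; exact: diff_linear.
- by move=> c cD j; apply: (indep p0 Up Mp c).
exists _, rho, D, w, r, C; split => //.
- exact: sumr_ge0.
- by move=> y yr; apply: Mrho; apply: rUP; exact: le_trans yr rleU.
- by move=> j y; exact: diff_linear.
- by move=> j y yr; have [_ dy _] := main j y yr; exact: differentiable_continuous.
- by move=> j y yr; have [_ dy _] := main j y yr; exact: diff_continuous.
- move=> j y v yr; have [_ dy _] := main j y yr.
  have := @is_derive_line R (Cn R n) R^o (rho j) y v 0.
  by rewrite scale0r addr0; apply.
- by move=> j y z v yr zr; have [_ _] := main j y yr; apply.
- move=> j y v yr yvr; apply: (@taylor_order2 R n (rho j) p0 r C) => // y' yr'.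
  by have [] := main j y' yr'.
- move=> j v; apply: (tangent_kernel oU Up).
    by move=> z Uz Mz; exact: ((Mrho z Uz).1 Mz).
  by have [|_ dy _] := main j p0; first by rewrite subrr normr0 ltW.
Qed.

(** [lyusternik] for the linear forms themselves: a vector on which they are small
    is close to a common zero. *)
Lemma kernel_approx k (L : 'I_k -> Cn R n -> R) (w : 'I_k -> Cn R n) (W : R) c :
  0 < W -> (forall j, `|w j| <= W) ->
  (forall j, linear_form (L j)) -> (forall j, continuous (L j)) ->
  (forall i j, k%:R * `|L i (w j) - (i == j)%:R| <= 1 / 2) ->
  exists c', (forall i, L i c' = 0) /\ `|c' - c| <= 4 * W * \sum_i `|L i c|.
Proof.
move=> W0 wW linL cL Lw.
apply: (@lyusternik R n k L (fun i _ v => L i v) w c (4 * W * (\sum_i `|L i c|) + 1) W) => //.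
- by rewrite ltr_wpDl// !mulr_ge0// ?sumr_ge0 ?(ltW W0).
- by move=> i y _; exact: cL.
- move=> i y v _.
  have -> : (fun t : R => L i (y + t *: v)) = (fun t => t * L i v + L i y).
    by apply/funext => t; rewrite addrC linL.
  by apply: is_derive_eq; rewrite /GRing.scale /=; ring.
- by move=> i _ c0; rewrite linear_sum_form.
- by rewrite ltrDl.
Qed.

Section NearPoint.
Variables (M : set (Cn R n)) (p0 : Cn R n) (k : nat) (rho : 'I_k -> Cn R n -> R).
Variables (D : 'I_k -> Cn R n -> Cn R n -> R) (w : 'I_k -> Cn R n) (r C : R).
Hypotheses (LE : local_equations M p0 rho D w r C) (Mp0 : M p0).

(** The differentials vary continuously, so the basis dual at p0 stays almost dual
    near p0, as [lyusternik] requires. *)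
Lemma dual_near : exists W r1 : R, [/\ 0 < W, 0 < r1, r1 <= r,
  forall j, `|w j| <= W &
  forall y i j, `|y - p0| <= r1 -> k%:R * `|D i y (w j) - (i == j)%:R| <= 1 / 2].
Proof.
have [r0 C0] := (eqs_radius LE, eqs_const LE).
pose W : R := 1 + \sum_j `|w j|.
have W0 : 0 < W by rewrite ltr_pwDl// sumr_ge0.
have kCW0 : 0 <= k%:R * C * W by rewrite !mulr_ge0// ltW.
pose r1 : R := Num.min r (1 / (2 * (k%:R * C * W + 1))).
have q0 : 0 < 2 * (k%:R * C * W + 1) by lra.
have r1r : r1 <= r by rewrite /r1 ge_min lexx.
have r1C : r1 <= 1 / (2 * (k%:R * C * W + 1)) by rewrite /r1 ge_min lexx orbT.
exists W, r1; split => //.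
- by rewrite lt_min r0 divr_gt0.
- by move=> j; rewrite /W (bigD1 j)//= addrCA lerDl addr_ge0// sumr_ge0.
move=> y i j yr; rewrite -(eqs_dual LE i j).
have p0r : `|p0 - p0| <= r by rewrite subrr normr0 ltW.
have wW : `|w j| <= W by rewrite /W (bigD1 j)//= addrCA lerDl addr_ge0// sumr_ge0.
apply: (@le_trans _ _ (k%:R * C * W * r1)).
  rewrite -!mulrA ler_wpM2l//.
  apply: le_trans (eqs_lip LE i (w j) (le_trans yr r1r) p0r) _.
  by rewrite -mulrA ler_wpM2l// mulrC ler_pM.
by move: r1C; rewrite ler_pdivlMr//; nra.
Qed.

Lemma dist_zero_set : exists r1 C1 : R, [/\ 0 < r1, r1 <= r, 0 <= C1 &
  forall x, `|x - p0| <= r1 ->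
    exists2 y, M y & `|y - x| <= C1 * \sum_i `|rho i x|].
Proof.
have [W [r2 [W0 r20 r2r wW Dw]]] := dual_near.
have p0r : `|p0 - p0| <= r by rewrite subrr normr0 ltW// (eqs_radius LE).
have rho0 : forall i, rho i p0 = 0 by have /(eqs_zero LE p0r) := Mp0.
have A0 : 0 < 4 * W by rewrite mulr_gt0.
pose e : R := r2 / 4 / (4 * W) / k.+1%:R.
have e0 : 0 < e by rewrite !divr_gt0.
have [r1 r10 r1P] : exists2 r1 : R, 0 < r1 & forall x, `|x - p0| <= r1 ->
    forall i, `|rho i x| <= e.
  apply: near_closed_ball.
  apply: (@filter_forall _ _ (fun i x => `|rho i x| <= e) (nbhs p0) _) => i.
  have ci : {for p0, continuous (rho i)} by exact: (eqs_cont LE).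
  by apply: (cvgr_norm_le _ ci); rewrite rho0 normr0.
have h1 : Num.min r1 (r2 / 2) <= r1 by rewrite ge_min lexx.
have h2 : Num.min r1 (r2 / 2) <= r2 / 2 by rewrite ge_min lexx orbT.
exists (Num.min r1 (r2 / 2)), (4 * W); split.
- by rewrite lt_min r10 divr_gt0.
- lra.
- exact: ltW.
move=> x xr; have xr1 := le_trans xr h1; have xr2 := le_trans xr h2.
have ball2 y : `|y - x| <= r2 / 2 -> `|y - p0| <= r2.
  move=> yx; have -> : y - p0 = (y - x) + (x - p0) by rewrite addrA subrK.
  by rewrite (le_trans (ler_normD _ _))//; lra.
have small : 4 * W * (\sum_i `|rho i x|) < r2 / 2.
  apply: (@le_lt_trans _ _ (4 * W * \sum_(i < k) e)).
    by rewrite ler_pM2l// ler_sum// => i _; exact: r1P.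
  rewrite sumr_const card_ord -[e *+ k]mulr_natl /e.
  have -> : 4 * W * (k%:R * (r2 / 4 / (4 * W) / k.+1%:R)) = k%:R / k.+1%:R * (r2 / 4).
    by move: (k.+1%:R^-1) => q; field; rewrite gt_eqF.
  apply: (@le_lt_trans _ _ (1 * (r2 / 4))); last by lra.
  apply: ler_wpM2r; first by lra.
  by rewrite ler_pdivrMr// mul1r ler_nat.
have r220 : 0 < r2 / 2 by lra.
have [i y yx|i y u yx|i y u|i j y yx|y [rhoy yx]] :=
    @lyusternik R n k rho D w x (r2 / 2) W r220 W0 wW _ _ _ _ small.
- by apply: (eqs_cont LE); exact: le_trans (ball2 y yx) r2r.
- by apply: (eqs_der LE); exact: le_trans (ball2 y yx) r2r.
- by rewrite linear_sum_form//; exact: (eqs_lin LE).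
- by apply: Dw; exact: ball2.
exists y => //; apply/(eqs_zero LE) => //; apply: le_trans r2r; apply: ball2.
by apply: le_trans yx _; exact: ltW.
Qed.

(** Taylor's formula gives rho (p + v) = O(|v|^2) for p in M and v in the kernel of
    the differentials at p; [dist_zero_set] finishes. *)
Lemma dist_kernel_vector : exists r1 C1 : R, [/\ 0 < r1, r1 <= r, 0 <= C1 &
  forall p v, M p -> `|p - p0| <= r1 -> `|v| <= r1 -> (forall i, D i p v = 0) ->
    exists2 y, M y & `|y - (p + v)| <= C1 * `|v| ^+ 2].
Proof.
have [r1 [C1 [r10 r1r C10 H]]] := dist_zero_set.
exists (r1 / 2), (C1 * (k%:R * C)); split; [lra|lra| |].
  by rewrite !mulr_ge0// (eqs_const LE).
move=> p v Mp pr vr Dv.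
have pv : `|p + v - p0| <= r1 by rewrite addrAC (le_trans (ler_normD _ _))//; lra.
have [y My yx] := H _ pv; exists y => //; apply: le_trans yx _.
rewrite -mulrA; apply: ler_wpM2l => //.
rewrite (@le_trans _ _ (\sum_(i < k) C * `|v| ^+ 2))//; last first.
  by rewrite sumr_const card_ord -[_ *+ k]mulr_natl mulrA.
have pr' : `|p - p0| <= r by lra.
apply: ler_sum => i _; have := eqs_taylor LE i pr' (le_trans pv r1r).
by rewrite Dv; have /(eqs_zero LE pr') -> := Mp; rewrite !subr0.
Qed.

Lemma kernel_near K0 : 0 <= K0 -> exists r1 Q : R, [/\ 0 < r1, r1 <= r, 0 <= Q &
  forall p c, `|p - p0| <= r1 -> `|c| <= K0 -> (forall j, D j p0 c = 0) ->
    exists c', (forall i, D i p c' = 0) /\ `|c' - c| <= Q * `|p - p0|].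
Proof.
move=> K00; have [W [r1 [W0 r10 r1r wW Dw]]] := dual_near.
have C0 := eqs_const LE.
exists r1, (4 * W * (k%:R * (C * K0))); split => //.
  by rewrite !mulr_ge0// ltW.
move=> p c pr cK c0.
have [|j|i j|c' [c'0 c'c]] := @kernel_approx k (fun i => D i p) w W c W0 wW.
- by move=> j; exact: (eqs_lin LE).
- by apply: (eqs_contD LE); exact: le_trans r1r.
- exact: Dw.
exists c'; split => //; apply: le_trans c'c _; rewrite -2!mulrA -[leRHS]mulrA.
apply: ler_wpM2l => //; rewrite -mulrA; apply: ler_wpM2l; first exact: ltW.
apply: (@le_trans _ _ (\sum_(i < k) C * (K0 * `|p - p0|))).
  apply: ler_sum => i _; rewrite -[D i p c]subr0 -(c0 i).
  have p0r : `|p0 - p0| <= r by rewrite subrr normr0 ltW// (eqs_radius LE).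
  apply: le_trans (eqs_lip LE i c (le_trans pr r1r) p0r) _.
  by rewrite -mulrA; apply: ler_wpM2l => //; rewrite mulrC; apply: ler_wpM2r.
by rewrite sumr_const card_ord -[_ *+ k]mulr_natl !mulrA.
Qed.


Lemma J_sum (I : finType) (c : I -> R) (F : I -> Cn R n) :
  J (\sum_l c l *: F l) = \sum_l c l *: J (F l).
Proof.
apply: (big_ind2 (fun u v => J u = v)).
- by rewrite /J /= oppr0.
- by move=> u u' v v' <- <-; rewrite J_D.
- by move=> l _; rewrite J_Z.
Qed.

Lemma norm_coord_sum h (F : 'I_(n + n) -> Cn R n) (f : 'I_(n + n) -> R) :
  (forall l, `|F l| <= f l) -> `|\sum_l coord h 0 l *: F l| <= (\sum_l f l) * `|h|.
Proof.
move=> Ff; rewrite (le_trans (ler_norm_sum _ _ _))// mulr_suml.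
apply: ler_sum => l _; rewrite normrZ mulrC; apply: ler_pM => //.
exact: coord_le.
Qed.

(** Genericity is used at p0 only, to split the 2n basis vectors; [kernel_near]
    moves the pieces into the kernels at p.  The error is proportional to
    |p - p0|, and below |h| / 8 in a small ball. *)
Lemma decompose_near : generic M -> exists r1 K : R, [/\ 0 < r1, r1 <= r, 0 <= K &
  forall p, `|p - p0| <= r1 -> forall h, exists a b : Cn R n,
    [/\ forall i, D i p a = 0, forall i, D i p b = 0,
      `|a| <= K * `|h|, `|b| <= K * `|h| & `|h - a - J b| <= `|h| / 8]].
Proof.
move=> gM.
have /choice[ul /= ulP] : forall l, exists uv : Cn R n * Cn R n,
    [/\ forall j, D j p0 uv.1 = 0, forall j, D j p0 uv.2 = 0 & @ebase R n l = uv.1 + J uv.2].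
  move=> l; have [u [v [tu tv e]]] := gM p0 Mp0 (@ebase R n l).
  by exists (u, v); split => //= j; exact: (eqs_tangent LE).
pose K0 : R := \sum_l (`|(ul l).1| + `|(ul l).2|).
have K00 : 0 <= K0 by rewrite sumr_ge0.
have uK l : `|(ul l).1| + `|(ul l).2| <= K0.
  by rewrite /K0 (bigD1 l)//= lerDl sumr_ge0.
have [r1 [Q [r10 r1r Q0 ker]]] := kernel_near K00.
pose d : R := (n + n)%:R.
have dQ0 : 0 <= d * Q by rewrite mulr_ge0.
have q0 : 0 < 16 * (d * Q + 1) by lra.
pose r2 : R := Num.min r1 (1 / (16 * (d * Q + 1))).
have h1 : r2 <= r1 by rewrite /r2 ge_min lexx.
have h2 : r2 <= 1 / (16 * (d * Q + 1)) by rewrite /r2 ge_min lexx orbT.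
exists r2, (K0 + 1); split.
- by rewrite lt_min r10 divr_gt0.
- exact: le_trans r1r.
- lra.
move=> p pr h.
pose eps : R := Q * `|p - p0|.
have deps : d * eps <= 1 / 16.
  move: (le_trans pr h2); rewrite ler_pdivlMr// /eps.
  by have := normr_ge0 (p - p0); nra.
have pr1 := le_trans pr h1.
have /choice[vl /= vlP] : forall l, exists uv : Cn R n * Cn R n,
    [/\ forall j, D j p uv.1 = 0, forall j, D j p uv.2 = 0,
     `|uv.1 - (ul l).1| <= eps & `|uv.2 - (ul l).2| <= eps].
  move=> l; have [u0 v0 _] := ulP l.
  have [|u' [u'0 u'e]] := ker p _ pr1 _ u0; first by apply: le_trans (uK l); rewrite lerDl.
  have [|v' [v'0 v'e]] := ker p _ pr1 _ v0; first by apply: le_trans (uK l); rewrite lerDr.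
  by exists (u', v').
have sumeps : \sum_(l < n + n) eps = d * eps by rewrite sumr_const card_ord -[_ *+ _]mulr_natl.
have bound (F : 'I_(n + n) -> Cn R n) (f : 'I_(n + n) -> R) :
    (forall l, `|F l| <= f l + eps) -> (forall l, f l <= `|(ul l).1| + `|(ul l).2|) ->
    `|\sum_l coord h 0 l *: F l| <= (K0 + 1) * `|h|.
  move=> Ff fu; apply: le_trans (norm_coord_sum h Ff) _; apply: ler_wpM2r => //.
  have fK : \sum_l f l <= K0 by exact: ler_sum.
  rewrite big_split /= sumeps; move: deps fK; lra.
exists (\sum_l coord h 0 l *: (vl l).1), (\sum_l coord h 0 l *: (vl l).2); split.
- move=> i; rewrite linear_sum_form; last exact: (eqs_lin LE).
  by apply: big1 => l _; have [-> _ _ _] := vlP l; rewrite mulr0.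
- move=> i; rewrite linear_sum_form; last exact: (eqs_lin LE).
  by apply: big1 => l _; have [_ -> _ _] := vlP l; rewrite mulr0.
- apply: (bound _ (fun l => `|(ul l).1|)) => l; last by rewrite lerDl.
  have [_ _ e1 _] := vlP l; rewrite -[(vl l).1](subrK (ul l).1).
  by rewrite (le_trans (ler_normD _ _))// addrC lerD2l.
- apply: (bound _ (fun l => `|(ul l).2|)) => l; last by rewrite lerDr.
  have [_ _ _ e1] := vlP l; rewrite -[(vl l).2](subrK (ul l).2).
  by rewrite (le_trans (ler_normD _ _))// addrC lerD2l.
have -> : h - \sum_l coord h 0 l *: (vl l).1 - J (\sum_l coord h 0 l *: (vl l).2)
   = \sum_l coord h 0 l *: (((ul l).1 - (vl l).1) + J ((ul l).2 - (vl l).2)).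
  rewrite {1}(coordE h) J_sum -!sumrB; apply: eq_bigr => l _.
  have [_ _ ->] := ulP l; rewrite -!scalerBr; congr (_ *: _).
  have JN z : J (- z) = - J z by rewrite -scaleN1r J_Z scaleN1r.
  by rewrite J_D JN addrA; congr (_ - _); rewrite addrAC.
apply: le_trans (norm_coord_sum h (f := fun=> eps + eps) _) _.
  move=> l; have [_ _ e1 e2] := vlP l.
  by rewrite (le_trans (ler_normD _ _))// norm_J; apply: lerD; rewrite distrC.
rewrite big_split /= sumeps mulrC; apply: ler_wpM2l => //.
move: deps; lra.
Qed.

End NearPoint.

(** Up to |h| / 8 the displacement h is a + J b, so p + h lies almost on the complex
    line through p + a in direction b, at parameter i, and the real points of that
    line are close to M to second order.  The single parameter N governs all
    constants; the property weakens as N grows, which suits a compactness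
    argument over nat. *)
Definition discs_near M (N : nat) p := forall h, `|h| <= N.+1%:R^-1 ->
  exists a b, [/\ `|a| <= N.+1%:R * `|h|, `|b| <= N.+1%:R * `|h|,
    `|h - a - J b| <= `|h| / 8 &
    forall t : R, `|t| * `|h| <= N.+1%:R^-1 ->
      exists2 y, M y & `|y - (p + a + t *: b)| <= N.+1%:R * (1 + t ^+ 2) * `|h| ^+ 2].

Lemma discs_near_mono M N N' p : (N <= N')%N -> discs_near M N p -> discs_near M N' p.
Proof.
move=> NN H h hN'.
have le1 : N.+1%:R <= N'.+1%:R :> R by rewrite ler_nat.
have le2 : N'.+1%:R^-1 <= N.+1%:R^-1 :> R by rewrite lef_pV2 ?posrE.
have [a [b [aN bN hab H']]] := H h (le_trans hN' le2).
exists a, b; split => //.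
- by apply: le_trans aN _; exact: ler_wpM2r.
- by apply: le_trans bN _; exact: ler_wpM2r.
move=> t tN'; have [y My yp] := H' t (le_trans tN' le2); exists y => //.
apply: le_trans yp _; apply: ler_wpM2r; first exact: sqr_ge0.
by apply: ler_wpM2r => //; rewrite addr_ge0 ?sqr_ge0.
Qed.

Lemma discs_nearP m M p0 : C2_submanifold m M -> generic M -> M p0 ->
  exists N, \forall p \near p0, M p -> discs_near M N p.
Proof.
move=> sM gM Mp0; have [k [rho [D [w [r [C LE]]]]]] := local_equationsP sM Mp0.
have [r1 [C1 [r10 _ C10 near1]]] := dist_kernel_vector LE Mp0.
have [r2 [K [r20 _ K0 near2]]] := decompose_near LE Mp0 gM.
have lin := eqs_lin LE.
pose X : R := K + 2 * K / r1 + 2 * C1 * K ^+ 2.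
have X1 : 0 <= 2 * K / r1 by rewrite divr_ge0 ?mulr_ge0// ltW.
have X2 : 0 <= 2 * C1 * K ^+ 2 by rewrite !mulr_ge0.
have [N XN] : exists N : nat, X <= N.+1%:R.
  exists (Num.bound X); apply: ltW; apply: lt_le_trans (archi_boundP _) _.
    by rewrite /X; move: K0 X1 X2; lra.
  by rewrite ler_nat.
have [KN rN CN] : [/\ K <= N.+1%:R, 2 * K / r1 <= N.+1%:R & 2 * C1 * K ^+ 2 <= N.+1%:R].
  by move: XN; rewrite /X; move: K0 X1 X2; split; lra.
exists N.
have : \forall p \near p0, `|p - p0| <= Num.min r1 r2.
  by apply: closed_ball_near; rewrite lt_min r10.
apply: filterS => p; rewrite le_min => /andP[pr1 pr2] Mp h hN.
have [a [b [Da Db aK bK hab]]] := near2 p pr2 h.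
exists a, b; split => //.
- by apply: le_trans aK _; exact: ler_wpM2r.
- by apply: le_trans bK _; exact: ler_wpM2r.
move=> t tN.
have Dv i : D i p (a + t *: b) = 0 by rewrite addrC lin Da Db mulr0 addr0.
have vK : `|a + t *: b| <= K * ((1 + `|t|) * `|h|).
  rewrite (le_trans (ler_normD _ _))// normrZ.
  have : `|t| * `|b| <= `|t| * (K * `|h|) by rewrite ler_wpM2l.
  by move: aK; lra.
have N0 : 0 < N.+1%:R :> R by [].
have vr : `|a + t *: b| <= r1.
  apply: le_trans vK _; apply: (@le_trans _ _ (K * (2 * N.+1%:R^-1))).
    apply: ler_wpM2l => //; rewrite mulrDl mul1r; move: hN tN.
    by move: (N.+1%:R^-1) => iN; lra.
  by rewrite mulrA ler_pdivrMr// [K * 2]mulrC [r1 * _]mulrC -ler_pdivrMr.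
have [y My yv] := near1 p _ Mp pr1 vr Dv; exists y => //.
rewrite -addrA; apply: le_trans yv _.
apply: (@le_trans _ _ (C1 * (2 * K ^+ 2 * ((1 + t ^+ 2) * `|h| ^+ 2)))).
  apply: ler_wpM2l => //.
  apply: (@le_trans _ _ ((K * ((1 + `|t|) * `|h|)) ^+ 2)).
    by rewrite !expr2; apply: ler_pM.
  have -> : 2 * K ^+ 2 * ((1 + t ^+ 2) * `|h| ^+ 2) = K ^+ 2 * (2 * (1 + t ^+ 2) * `|h| ^+ 2).
    by ring.
  rewrite exprMn; apply: ler_wpM2l; first exact: sqr_ge0.
  rewrite exprMn; apply: ler_wpM2r; first exact: sqr_ge0.
  rewrite -(real_normK (num_real t)); have := sqr_ge0 (`|t| - 1); nra.
have -> : C1 * (2 * K ^+ 2 * ((1 + t ^+ 2) * `|h| ^+ 2))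
  = 2 * C1 * K ^+ 2 * (1 + t ^+ 2) * `|h| ^+ 2 by ring.
apply: ler_wpM2r; first exact: sqr_ge0.
by apply: ler_wpM2r => //; rewrite addr_ge0 ?sqr_ge0.
Qed.

Lemma uniform_discs m M : compact M -> C2_submanifold m M -> generic M ->
  exists N, forall p, M p -> discs_near M N p.
Proof.
move=> cM sM gM.
have /compact_near_coveringP/(_ nat \oo (fun N p => M p -> discs_near M N p)) := cM.
have FF : Filter (\oo : set_system nat) by exact: _.
move=> /(_ FF)[p0 Mp0|N _ NP].
  have [N Np] := discs_nearP sM gM Mp0.
  exists ([set p | M p -> discs_near M N p], [set N' | (N <= N')%N]) => /=.
    by split => //; exact: nbhs_infty_ge.
  by move=> [p N'] /= [H NN] Mp; apply: discs_near_mono NN _; exact: H.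
exists N => p Mp; exact: (NP N (leqnn N) p Mp Mp).
Qed.

End UniformGeometry.
(** * Estimates near M *)

Section Growth.
Variables (R : realType) (n : nat) (M : set (Cn R n)).
Implicit Types (p y z h : Cn R n) (u : Cn R n -> \bar R).

(** A bound for u on the neighbourhood of M of radius r1, in terms of the
    displacement from a point of M. *)
Definition near_bound (r1 : R) (b : R -> R) u :=
  forall p h, M p -> `|h| <= r1 -> (u (p + h)%R <= (b `|h|)%:E)%E.

Lemma scaleC_le (l : R[i]) z (T : R) : `|complex.Re l| <= T -> `|complex.Im l| <= T ->
  `|scaleC l z| <= 2 * T * `|z|.
Proof.
move=> h1 h2; rewrite /scaleC (le_trans (ler_normD _ _))// !normrZ norm_J -mulrDl.
by apply: ler_wpM2r => //; lra.
Qed.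

(** Apply [box_estimate] to u on the complex line l |-> p + h - J b + l b, for the
    box of size T = s / |h|, whose image has diameter of order s.  At a real
    point t the line is within |h| / 8 + K (1 + t^2) |h|^2 of M, so there the
    hypothesis bounds u by B times this distance plus eta; elsewhere u <= C0.  With
    G = B K |h|^2 + C0 / T^2, the result at i is at most
    eta + B |h| (1/8 + K |h| + 3 K s) + (3 / s) C0 |h|, and s is small enough for
    the factor of B |h| to be below 1/2. *)
Lemma one_step : (exists N, forall p, M p -> discs_near M N p) ->
  exists r1 K1 : R, [/\ 0 < r1, r1 <= 1, 0 <= K1 &
  forall u (C0 B eta : R), plurisubharmonic u -> 0 < C0 -> 0 <= B -> 0 <= eta ->
    near_bound r1 (fun=> C0) u -> near_bound r1 (fun t => B * t + eta) u ->
    near_bound r1 (fun t => (B / 2 + K1 * C0) * t + eta) u].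
Proof.
move=> [N discs]; pose K : R := N.+1%:R.
have K1 : 1 <= K by rewrite ler1n.
have K0 : 0 < K by lra.
rewrite /discs_near -/K in discs; clearbody K.
(* K s = 1 / (16 K) controls both the contraction and the size of the box,
   which has to stay within 1 / K of M *)
pose s : R := (16 * K ^+ 2)^-1.
have s0 : 0 < s by rewrite invr_gt0 mulr_gt0// exprn_gt0.
have iK0 : 0 < K^-1 by rewrite invr_gt0.
have sK : K * s = K^-1 / 16 by rewrite /s; field; rewrite gt_eqF.
have iK1 : K^-1 <= 1 by rewrite invf_le1.
have siK : s <= K^-1 / 16.
  by rewrite -sK ler_peMl// ltW.
clearbody s.
exists K^-1, (3 / s); split => //; first by rewrite divr_ge0// ltW.
move=> u C0 B eta psh C00 B0 eta0 uC uB p h Mp hK.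
have BK0 : 0 <= B / 2 by rewrite divr_ge0.
have h0 := normr_ge0 h.
(* displacements larger than s: the bound by C0 suffices *)
have [hs|hs] := ltP s `|h|.
  apply: le_trans (uC p h Mp hK) _; rewrite lee_fin.
  have : C0 <= 3 / s * C0 * `|h|.
    have -> : 3 / s * C0 * `|h| = C0 * (3 * `|h|) / s by ring.
    by rewrite ler_pdivlMr//; apply: ler_wpM2l; [exact: ltW|lra].
  by rewrite mulrDl; have := mulr_ge0 BK0 h0; lra.
have [h00|hn0] := eqVneq h 0.
  by apply: le_trans (uB p h Mp hK) _; rewrite lee_fin h00 normr0 !mulr0.
have hp : 0 < `|h| by rewrite normr_gt0.
have [a [b [aK bK hab disc]]] := discs p Mp h hK.
pose T : R := s / `|h|.
have T0 : 0 < T by rewrite divr_gt0.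
have Th : T * `|h| = s by rewrite /T divfK// gt_eqF.
have T1 : 1 <= T by rewrite /T ler_pdivlMr// mul1r.
pose q : Cn R n := p + h - J b.
pose f (l : R[i]) := u (q + scaleC l b).
have sf : subharmonic f by have [_ _] := psh; apply.
pose G : R := B * K * `|h| ^+ 2 + C0 / T ^+ 2.
pose a0 : R := eta + B * `|h| / 8 + B * K * `|h| ^+ 2.
have BKh : 0 <= B * K * `|h| ^+ 2 by rewrite !mulr_ge0// ltW.
have G0 : 0 < G by rewrite ltr_wpDl// divr_gt0// exprn_gt0.
have Bh : 0 <= B * `|h| by rewrite mulr_ge0.
have qE : q = p + a + (h - a - J b).
  by rewrite /q addrA; congr (_ - _); rewrite -[RHS]addrA; congr (_ + _); rewrite addrC subrK.
have fi : f (0%R +i* 1%R)%C = u (p + h).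
  by rewrite /f /scaleC /= scale0r add0r scale1r /q subrK.
rewrite -fi.
apply: le_trans (@box_estimate R f T G a0 C0 sf T1 G0 _ _ _) _.
- rewrite /a0 /G mulrDl divfK; last by rewrite gt_eqF// exprn_gt0.
  have : 0 <= B * K * `|h| ^+ 2 * T ^+ 2 by rewrite mulr_ge0// sqr_ge0.
  lra.
- move=> x xT; have [|y My yx] := disc x.
    apply: (@le_trans _ _ (T * `|h|)); first exact: ler_wpM2r.
    by rewrite Th; lra.
  have -> : f (x +i* 0%R)%C = u (y + (q + x *: b - y)).
    by rewrite addrC subrK /f /scaleC /= scale0r addr0.
  have near : `|q + x *: b - y| <= `|h| / 8 + K * (1 + x ^+ 2) * `|h| ^+ 2.
    have -> : q + x *: b - y = (h - a - J b) + (p + a + x *: b - y).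
      by rewrite qE -[in LHS](addrC (h - a - J b)) -!addrA.
    by rewrite (le_trans (ler_normD _ _))// lerD// distrC.
  have xs : x ^+ 2 * `|h| ^+ 2 <= s ^+ 2.
    rewrite -exprMn -Th -(real_normK (num_real (x * _))) normrM normr_id.
    rewrite !expr2; apply: ler_pM; rewrite ?mulr_ge0//; exact: ler_wpM2r.
  have hs2 : `|h| ^+ 2 <= s ^+ 2 by rewrite !expr2; apply: ler_pM.
  apply: le_trans (uB y _ My _) _.
    apply: le_trans near _.
    have -> : K * (1 + x ^+ 2) * `|h| ^+ 2 = K * (`|h| ^+ 2 + x ^+ 2 * `|h| ^+ 2) by ring.
    have : K * (`|h| ^+ 2 + x ^+ 2 * `|h| ^+ 2) <= K * (s ^+ 2 + s ^+ 2).
      by apply: ler_wpM2l; [exact: ltW|exact: lerD].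
    have -> : K * (s ^+ 2 + s ^+ 2) = 2 * (K * s) * s by ring.
    rewrite sK => h2; apply: (@le_trans _ _ (s / 8 + 2 * (K^-1 / 16) * s)); first by lra.
    have : K^-1 * s <= s by rewrite ler_piMl// ltW.
    lra.
  rewrite lee_fin /a0 /G.
  have : B * `|q + x *: b - y| <= B * (`|h| / 8 + K * (1 + x ^+ 2) * `|h| ^+ 2) by exact: ler_wpM2l.
  have : 0 <= C0 / T ^+ 2 * x ^+ 2 by rewrite mulr_ge0 ?sqr_ge0// divr_ge0 ?sqr_ge0// ltW.
  lra.
- move=> x y xT y0 yT; have yT' : `|y| <= T by rewrite ger0_norm.
  have -> : f (x +i* y)%C = u (p + (a + (h - a - J b) + scaleC (x +i* y)%C b)).
    by rewrite /f qE -!addrA.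
  apply: uC => //.
  rewrite (le_trans (ler_normD _ _))//.
  have := scaleC_le (l := (x +i* y)%C) b xT yT'.
  have : 2 * T * `|b| <= 2 * T * (K * `|h|) by apply: ler_wpM2l => //; lra.
  have -> : 2 * T * (K * `|h|) = 2 * (K * s) by rewrite -Th; ring.
  have : K * `|h| <= K * s by apply: ler_wpM2l => //; exact: ltW.
  have := ler_normD a (h - a - J b).
  rewrite sK; lra.
rewrite lee_fin /a0 /G.
have -> : 3 * T * (B * K * `|h| ^+ 2 + C0 / T ^+ 2) = 3 * B * (K * s) * `|h| + 3 / s * C0 * `|h|.
  by rewrite -{1}Th /T; field; rewrite !gt_eqF.
have : B * K * `|h| ^+ 2 <= B * `|h| * (K * s).
  have -> : B * K * `|h| ^+ 2 = B * `|h| * (K * `|h|) by ring.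
  by apply: ler_wpM2l => //; apply: ler_wpM2l => //; exact: ltW.
rewrite sK.
have : B * `|h| * (K^-1 / 16) <= B * `|h| * (1 / 16) by apply: ler_wpM2l => //; lra.
lra.
Qed.

End Growth.
(** The map B |-> B / 2 + c contracts to its fixed point 2 c. *)
Lemma halving (R : realType) (P : R -> Prop) (c B0 : R) : 0 <= c -> 0 <= B0 -> P B0 ->
  (forall B, 0 <= B -> P B -> P (B / 2 + c)) ->
  forall e, 0 < e -> exists B, [/\ 0 <= B, B <= 2 * c + e & P B].
Proof.
move=> c0 B00 PB0 step e e0.
have iterated j : exists B, [/\ 0 <= B, B <= 2 * c + B0 / 2 ^+ j & P B].
  elim: j => [|j [B [B1 B2 PB]]]; first by exists B0; split => //; rewrite expr0 divr1; lra.
  exists (B / 2 + c); split; [lra| |exact: step].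
  have -> : B0 / 2 ^+ j.+1 = B0 / 2 ^+ j / 2 by rewrite exprS; field; rewrite expf_neq0.
  lra.
pose j := Num.bound (B0 / e).
have [B [B1 B2 PB]] := iterated j; exists B; split => //; apply: le_trans B2 _.
rewrite lerD2l ler_pdivrMr ?exprn_gt0// mulrC -ler_pdivrMr//.
apply: ltW; apply: lt_le_trans (archi_boundP _) _; first by rewrite divr_ge0// ltW.
by rewrite -natrX ler_nat ltnW// ltn_expl.
Qed.

Section GrowthNear.
Variables (R : realType) (n : nat) (M : set (Cn R n)).
Implicit Types (p y z h : Cn R n) (u : Cn R n -> \bar R).

(** Upper semicontinuity and compactness give u < eta at distance at most some
    1 / (N + 1) from M; farther away, C0 <= C0 (N + 1) |h|. *)
Lemma usc_start u (r1 C0 eta : R) : compact M -> upper_semicontinuous u ->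
  (forall p, M p -> (u p <= 0)%E) -> 0 <= C0 -> 0 < eta -> near_bound M r1 (fun=> C0) u ->
  exists2 B : R, 0 <= B & near_bound M r1 (fun t => B * t + eta) u.
Proof.
move=> cM uu u0 C00 eta0 uC.
have [N NP] : exists N : nat, forall p, M p -> forall h, `|h| <= N.+1%:R^-1 ->
    (u (p + h)%R < eta%:E)%E.
  pose Q (N : nat) p := forall h, `|h| <= N.+1%:R^-1 -> (u (p + h)%R < eta%:E)%E.
  have /compact_near_coveringP/(_ nat \oo Q _) := cM.
  case => [p0 Mp0|N _ NP].
    have [|r r0 rP] := near_closed_ball (P := fun z => (u z < eta%:E)%E) (p := p0).
      by apply: usc_near => //; apply: le_lt_trans (u0 p0 Mp0) _; rewrite lte_fin.
    have r20 : 0 < r / 2 by lra.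
    pose N0 := Num.bound (r / 2)^-1.
    exists ([set p | `|p - p0| <= r / 2], [set N | (N0 <= N)%N]) => /=.
      by split; [exact: closed_ball_near|exact: nbhs_infty_ge].
    move=> [p N] /= [pr N0N] h hN; apply: rP.
    have Nr : N.+1%:R^-1 <= r / 2.
      rewrite invf_ple ?posrE//; apply: ltW.
      apply: lt_le_trans (archi_boundP _) _; first by rewrite invr_ge0 ltW.
      by rewrite ler_nat; exact: leqW.
    have hr := le_trans hN Nr; clear hN Nr.
    by rewrite addrAC (le_trans (ler_normD _ _))//; lra.
  by exists N => p Mp; exact: (NP N (leqnn N) p Mp).
have N0 : 0 < N.+1%:R :> R by [].
exists (C0 * N.+1%:R); first by rewrite mulr_ge0.
move=> p h Mp hr; have h0 := normr_ge0 h.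
have CN : 0 <= C0 * N.+1%:R * `|h| by rewrite !mulr_ge0.
have [hN|hN] := leP `|h| N.+1%:R^-1.
  by apply: le_trans (ltW (NP p Mp h hN)) _; rewrite lee_fin lerDr.
apply: le_trans (uC p h Mp hr) _; rewrite lee_fin.
apply: (@le_trans _ _ (C0 * N.+1%:R * `|h|)); last by rewrite lerDl ltW.
rewrite -mulrA ler_peMr// mulrC.
by move: hN; rewrite -[_^-1]mul1r ltr_pdivrMr// => /ltW.
Qed.

(** [one_step] is iterated with eta = e / 2 until B is below 2 K1 C0 + e / 2; then e
    tends to 0. *)
Lemma lipschitz_near : compact M -> (exists N, forall p, M p -> discs_near M N p) ->
  exists r1 K : R, [/\ 0 < r1, r1 <= 1, 0 <= K &
  forall u (C0 : R), plurisubharmonic u -> 0 < C0 -> (forall p, M p -> (u p <= 0)%E) ->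
    near_bound M r1 (fun=> C0) u -> near_bound M r1 (fun t => K * C0 * t) u].
Proof.
move=> cM /one_step[r1 [K1 [r10 r11 K10 step]]].
exists r1, (2 * K1); split => //; first by rewrite mulr_ge0.
move=> u C0 psh C00 u0 uC p h Mp hr.
have h0 := normr_ge0 h.
apply/lee_addgt0Pr => e e0; rewrite -EFinD.
have e20 : 0 < e / 2 by lra.
have [uu _ _] := psh.
have [B0 B00 PB0] := usc_start cM uu u0 (ltW C00) e20 uC.
have KC : 0 <= K1 * C0 by rewrite mulr_ge0// ltW.
have [B [B1 B2 PB]] := halving KC B00 PB0
  (fun B B0 PB => step u C0 B (e / 2) psh C00 B0 (ltW e20) uC PB) e20.
apply: le_trans (PB p h Mp hr) _; rewrite lee_fin.
have : B * `|h| <= (2 * (K1 * C0) + e / 2) * `|h| by exact: ler_wpM2r.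
have : e / 2 * `|h| <= e / 2 by rewrite ler_piMr ?(ltW e20)//; exact: le_trans r11.
lra.
Qed.

End GrowthNear.
(** * Growth in the Lelong class *)

Section LelongClass.
Variables (R : realType) (n : nat).
Implicit Types (p y z h : Cn R n) (u : Cn R n -> \bar R).

Lemma norm_le_enorm z : `|z| <= enorm z.
Proof.
have H (j : 'I_n) : z.1 0 j ^+ 2 + z.2 0 j ^+ 2 <= enorm z ^+ 2.
  rewrite sqr_sqrtr; last by apply: sumr_ge0 => i _; rewrite addr_ge0 ?sqr_ge0.
  by rewrite (bigD1 j)//= lerDl sumr_ge0// => i _; rewrite addr_ge0 ?sqr_ge0.
have e0 : 0 <= enorm z by exact: sqrtr_ge0.
apply/(norm_le_coord _ e0) => l; rewrite mxE.
case: splitP => j _; rewrite -(@ler_pXn2r _ 2) ?nnegrE// real_normK ?num_real//;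
  apply: le_trans (H j); rewrite ?lerDl ?lerDr sqr_ge0//.
Qed.

Lemma enorm_le_norm z : enorm z <= (n + n).+1%:R * `|z|.
Proof.
have z0 := normr_ge0 z.
rewrite -(@ler_pXn2r _ 2) ?nnegrE ?sqrtr_ge0 ?mulr_ge0//.
rewrite sqr_sqrtr; last by apply: sumr_ge0 => i _; rewrite addr_ge0 ?sqr_ge0.
have c1 (j : 'I_n) : z.1 0 j ^+ 2 <= `|z| ^+ 2.
  rewrite -(real_normK (num_real (z.1 0 j))) ler_pXn2r ?nnegrE//.
  by have := coord_le z (lshift n j); rewrite /coord row_mxEl.
have c2 (j : 'I_n) : z.2 0 j ^+ 2 <= `|z| ^+ 2.
  rewrite -(real_normK (num_real (z.2 0 j))) ler_pXn2r ?nnegrE//.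
  by have := coord_le z (rshift n j); rewrite /coord row_mxEr.
apply: (@le_trans _ _ (\sum_(j < n) (`|z| ^+ 2 + `|z| ^+ 2))).
  by apply: ler_sum => j _; exact: lerD.
rewrite sumr_const card_ord -mulr2n -mulrnA exprMn -[_ *+ (2 * n)]mulr_natl.
apply: ler_wpM2r; first exact: sqr_ge0.
by rewrite -natrX ler_nat mul2n -addnn -mulnn; exact: leq_trans (leqnSn _) (leq_pmulr _ _).
Qed.

Lemma log_plusE (x : R) : 0 <= x -> log_plus x = ln (Num.max 1 x).
Proof.
move=> x0; rewrite /log_plus; have [x1|x1] := leP x 1.
  by rewrite ln1; apply/max_idPl; rewrite ln_le0.
by apply/max_idPr; rewrite ln_ge0// ltW.
Qed.

(** A comparison of norms up to a factor changes the logarithm by a constant. *)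
Lemma log_plus_le (A x y : R) : 1 <= A -> 0 <= x -> 0 <= y -> x <= A * Num.max 1 y ->
  log_plus x <= ln A + log_plus y.
Proof.
move=> A1 x0 y0 xy.
have m1 : 1 <= Num.max 1 y by rewrite le_max lexx.
have A0 : 0 < A by lra.
have m0 : 0 < Num.max 1 y by lra.
rewrite !log_plusE// -lnM ?posrE// ler_ln ?posrE ?mulr_gt0//; last by rewrite lt_max ltr01.
by rewrite ge_max xy andbT; nra.
Qed.

Lemma LelongP u : Lelong u <-> plurisubharmonic u /\
  exists c : R, forall z, (u z <= (c + log_plus (enorm z))%:E)%E.
Proof.
split=> -[psh H]; split => //.
  exists (fine (ereal_sup (range (fun z => u z - (log_plus (enorm z))%:E)%E))) => z.
  set S := ereal_sup _ in H *.
  have zS : (u z - (log_plus (enorm z))%:E <= S)%E by apply: ereal_sup_ubound; exists z.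
  rewrite EFinD -leeBlDr//; apply: le_trans zS _.
  by move: H; case: S => [s| |] //; rewrite leNye.
case: H => c uc; apply: (@le_lt_trans _ _ c%:E); last exact: ltry.
apply: ge_ereal_sup => _ [z _ <-]; rewrite leeBlDr//.
Qed.

Lemma Lelong_cst0 : Lelong (cst 0%E : Cn R n -> \bar R).
Proof.
apply/LelongP; split; last first.
  by exists 0 => z; rewrite lee_fin add0r /log_plus le_max lexx.
split.
- exact: usc_cst.
- by move=> z; rewrite ltry.
move=> a b; split.
- exact: (@usc_cst R (R * R)%type 0%E).
- by move=> l; rewrite ltry.
- by move=> c r r0; rewrite integral0 mule0.
Qed.

(** The Lelong class is invariant under translations, which change log |z| by a
    bounded amount, and under subtraction of constants. *)
Lemma Lelong_shift u h (k : R) : Lelong u -> Lelong (fun z => u (z + h)%R - k%:E)%E.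
Proof.
move=> /LelongP[[uu uy us] [c uc]]; apply/LelongP; split.
  split.
  - apply: (usc_subr (h := fun=> k)); last by move=> ?; exact: cvg_cst.
    apply: (usc_comp (g := fun z => z + h)) => //.
    by move=> z; apply: cvgD; [exact: cvg_id|exact: cvg_cst].
  - by move=> z; case: (u (z + h)) (uy (z + h)) => [x| |] //= _; rewrite -EFinB ltry.
  - move=> a b; have := subharmonic_subr k (us (a + h) b).
    have -> : (fun l => u (a + h + scaleC l b)%R - k%:E)%E = (fun l => u (a + scaleC l b + h)%R - k%:E)%E.
      by apply/funext => l; rewrite addrAC.
    by [].
pose E : R := (n + n).+1%:R.
have E1 : 1 <= E by rewrite ler1n.
pose A : R := E * (1 + `|h|).
have h0 := normr_ge0 h.
have A1 : 1 <= A by rewrite /A; nra.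
exists (c + ln A - k) => z; rewrite leeBlDr//; apply: le_trans (uc _) _.
rewrite -EFinD lee_fin.
have : log_plus (enorm (z + h)) <= ln A + log_plus (enorm z).
  apply: log_plus_le; rewrite ?sqrtr_ge0//.
  apply: le_trans (enorm_le_norm _) _; rewrite -/E /A -mulrA.
  apply: ler_wpM2l; first by lra.
  have m1 : 1 <= Num.max 1 (enorm z) by rewrite le_max lexx.
  have m2 : `|z| <= Num.max 1 (enorm z) by rewrite le_max norm_le_enorm orbT.
  rewrite (le_trans (ler_normD _ _))//; nra.
lra.
Qed.

(** [log_estimate] on the complex line through p and z.  The radius r / 2 leaves
    room for the sup norm of a complex multiple, which is at most twice the modulus
    times the norm. *)
Lemma ball_growth u p (r Q S : R) : Lelong u -> 0 < r -> r <= Q ->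
  (forall z, `|z - p| <= r -> (u z <= S%:E)%E) ->
  forall z, `|z - p| <= Q -> (u z <= (S + ln (Q ^+ 2 / (r / 2) ^+ 2))%:E)%E.
Proof.
move=> /LelongP[[_ _ us] [c uc]] r0 rQ uS z zQ.
have r20 : 0 < r / 2 by lra.
have Q0 : 0 < Q by lra.
have lnpos : 0 <= ln (Q ^+ 2 / (r / 2) ^+ 2).
  rewrite ln_ge0// ler_pdivlMr ?exprn_gt0// mul1r; nra.
have [zr|zr] := leP `|z - p| (r / 2).
  by apply: le_trans (uS z _) _; [lra|rewrite lee_fin lerDl].
pose rho : R := `|z - p|; have rho0 : 0 < rho by rewrite /rho; lra.
pose b : Cn R n := rho^-1 *: (z - p).
have b1 : `|b| = 1 by rewrite normrZ normfV gtr0_norm// mulVf// gt_eqF.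
pose f (l : R[i]) := u (p + scaleC l b).
pose E : R := (n + n).+1%:R.
have E1 : 1 <= E by rewrite ler1n.
pose A : R := E * (`|p| + 2).
have p0 := normr_ge0 p.
have A1 : 1 <= A by rewrite /A; nra.
have est (x y T : R) : 0 <= T -> x ^+ 2 + y ^+ 2 <= T ^+ 2 -> `|scaleC (x +i* y)%C b| <= 2 * T.
  move=> T0 xyT; have := @scaleC_le R n (x +i* y)%C b T; rewrite b1 mulr1; apply => /=.
    by rewrite ler_norml; apply/andP; split; nra.
  by rewrite ler_norml; apply/andP; split; nra.
have -> : u z = f (rho +i* 0)%C.
  by rewrite /f /scaleC /= scale0r addr0 /b scalerA divff ?gt_eqF// scale1r addrC subrK.
apply: le_trans (@log_estimate R f S (c + ln A) (r / 2) (us p b) r20 _ _ rho 0 _) _.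
- move=> x y xy; apply: uS; rewrite addrAC subrr add0r.
  by apply: le_trans (est x y (r / 2) (ltW r20) xy) _; lra.
- move=> x y xy1; apply: le_trans (uc _) _; rewrite lee_fin -addrA lerD2l.
  pose T : R := Num.sqrt (x ^+ 2 + y ^+ 2).
  have T2 : T ^+ 2 = x ^+ 2 + y ^+ 2 by rewrite sqr_sqrtr; lra.
  have T0 : 0 <= T by exact: sqrtr_ge0.
  have T1 : 1 <= T by nra.
  have -> : ln (x ^+ 2 + y ^+ 2) / 2 = log_plus T.
    rewrite -T2 lnXn ?log_plusE//; last by lra.
    by rewrite (max_idPr T1) -[_ *+ 2]mulr_natr mulfK// pnatr_eq0.
  apply: log_plus_le => //; first exact: sqrtr_ge0.
  apply: le_trans (enorm_le_norm _) _; rewrite -/E /A -mulrA.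
  apply: ler_wpM2l; first by lra.
  rewrite (max_idPr T1) (le_trans (ler_normD _ _))//.
  by have := est x y T T0; rewrite T2 => /(_ (lexx _)); nra.
- by rewrite expr0n /= addr0 ler_pXn2r ?nnegrE ?(ltW r20) ?(ltW rho0)//; exact: ltW.
rewrite lee_fin lerD2l expr0n /= addr0 ler_ln ?posrE ?divr_gt0 ?exprn_gt0//.
by rewrite ler_wpM2r ?invr_ge0 ?sqr_ge0// ler_pXn2r ?nnegrE ?(ltW Q0) ?(ltW rho0).
Qed.

End LelongClass.
(** * The Green function *)

Section GreenFunction.
Variables (R : realType) (n : nat) (M : set (Cn R n)).
Implicit Types (p y z h : Cn R n) (u : Cn R n -> \bar R).

Definition admissible u := Lelong u /\ forall x, M x -> (u x <= 0)%E.

(** From a bound C0 near M, [lipschitz_near] gives u <= C0 / 2 on the ball of radius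
    r about p0, and [ball_growth] then gives u <= C0 / 2 + L0 on a ball containing
    the neighbourhood of M.  By [halving] C0 can be taken independent of u. *)
Lemma uniform_lipschitz : compact M -> M !=set0 ->
  (exists N, forall p, M p -> discs_near M N p) ->
  exists r1 A : R, [/\ 0 < r1, 0 < A &
    forall u, admissible u -> near_bound M r1 (fun t => A * t) u].
Proof.
move=> cM [p0 Mp0] discs.
have [r1 [K [r10 r11 K0 lip]]] := lipschitz_near cM discs.
(* a ball about p0 containing the neighbourhood of M *)
have [Q [Q1 QP]] : exists Q : R, r1 <= Q /\ forall p h, M p -> `|h| <= r1 -> `|p + h - p0| <= Q.
  have [D [_ DP]] := compact_bounded cM.
  pose D1 : R := `|D| + 1.
  have D10 : 0 <= D1 by rewrite addr_ge0.
  exists (D1 + r1 + `|p0|); split; first by have := normr_ge0 p0; lra.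
  move=> p h Mp hr; rewrite (le_trans (ler_normB _ _))// lerD2r.
  rewrite (le_trans (ler_normD _ _))// lerD//; apply: DP => //.
  by rewrite /D1 ltr_pwDr// ler_norm.
pose r : R := Num.min r1 (1 / (2 * (K + 1))).
have K1 : 0 < 2 * (K + 1) by lra.
have r0 : 0 < r by rewrite lt_min r10 divr_gt0.
have rr1 : r <= r1 by rewrite /r ge_min lexx.
have rK : K * r <= 1 / 2.
  have : r <= 1 / (2 * (K + 1)) by rewrite /r ge_min lexx orbT.
  by rewrite ler_pdivlMr//; nra.
pose L0 : R := ln (Q ^+ 2 / (r / 2) ^+ 2).
have L00 : 0 <= L0.
  by rewrite /L0 ln_ge0// ler_pdivlMr ?exprn_gt0 ?divr_gt0// mul1r; nra.
pose c : R := L0 + 1.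
have c0 : 0 <= c by rewrite /c; lra.
(* the bound near M that is common to all admissible functions *)
pose C1 : R := 2 * c + 1.
exists r1, (K * C1 + 1); split => //; first by rewrite ltr_wpDl// mulr_ge0// /C1; lra.
move=> u [Lu u0]; have [psh _] := (LelongP u).1 Lu.
have mono (B B' : R) : B <= B' -> near_bound M r1 (fun=> B) u -> near_bound M r1 (fun=> B') u.
  by move=> BB H p h Mp hr; apply: le_trans (H p h Mp hr) _; rewrite lee_fin.
have [B0 B00 PB0] : exists2 B : R, 0 <= B & near_bound M r1 (fun=> B) u.
  have [uu uy _] := psh.
  have [B B0 BP] := usc_bounded uu uy (@compact_ball_Cn R n p0 Q).
  by exists B => // p h Mp hr; apply: BP; exact: QP.
(* [lipschitz_near] asks for a positive bound: B + 1 replaces B *)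
have step (B : R) : 0 <= B -> near_bound M r1 (fun=> B) u -> near_bound M r1 (fun=> B / 2 + c) u.
  move=> B1 PB.
  have Bp : 0 < B + 1 by lra.
  have lipB := lip u (B + 1) psh Bp u0 (mono B (B + 1) _ PB).
  have uS z : `|z - p0| <= r -> (u z <= ((B + 1) / 2)%:E)%E.
    move=> zr; have -> : z = p0 + (z - p0) by rewrite addrC subrK.
    apply: le_trans (lipB _ p0 (z - p0) Mp0 (le_trans zr rr1)) _; first by rewrite lerDl.
    have Kz : K * `|z - p0| <= 1 / 2 by apply: le_trans rK; exact: ler_wpM2l.
    rewrite lee_fin (_ : K * (B + 1) * _ = (B + 1) * (K * `|z - p0|)); last by ring.
    by apply: ler_wpM2l; [exact: ltW|rewrite -[_^-1]mul1r].
  move=> p h Mp hr.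
  apply: le_trans (ball_growth Lu r0 (le_trans rr1 Q1) uS (QP p h Mp hr)) _.
  by rewrite lee_fin -/L0 /c; lra.
have [B [B1 B2 PB]] := halving c0 B00 PB0 step ltr01.
have C10 : 0 < C1 by rewrite /C1; lra.
move=> p h Mp hr; apply: le_trans (lip u C1 psh C10 u0 (mono B C1 B2 PB) p h Mp hr) _.
by rewrite lee_fin mulrDl mul1r lerDl.
Qed.

Lemma green_ge0 z : (0 <= green M z)%E.
Proof.
apply: ereal_sup_ubound; exists (cst 0%E) => //.
by split => //; exact: Lelong_cst0.
Qed.

Lemma green_on z : M z -> (green M z <= 0)%E.
Proof. by move=> Mz; apply: ge_ereal_sup => _ [u [_ u0] <-]; exact: u0. Qed.

(** If u is admissible then so is z |-> u (z + h) - A |h|, by the estimate on M. *)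
Lemma green_translate (r1 A : R) :
  (forall u, admissible u -> near_bound M r1 (fun t => A * t) u) ->
  forall z h, `|h| <= r1 -> (green M (z + h)%R <= green M z + (A * `|h|)%:E)%E.
Proof.
move=> H z h hr; apply: ge_ereal_sup => _ [u [Lu u0] <-].
rewrite -leeBlDr//; apply: ereal_sup_ubound.
exists (fun x => u (x + h)%R - (A * `|h|)%:E)%E => //.
split; first exact: Lelong_shift.
move=> x Mx; rewrite leeBlDr// add0e.
exact: (H u (conj Lu u0) x h Mx hr).
Qed.

Lemma green_lipschitz (r1 A : R) : 0 < r1 ->
  (forall u, admissible u -> near_bound M r1 (fun t => A * t) u) ->
  forall z h, (green M (z + h)%R <= green M z + (A * `|h|)%:E)%E.
Proof.
move=> r10 H z h.
pose N := (Num.bound (`|h| / r1)).+1.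
have N0 : 0 < N%:R :> R by rewrite ltr0n.
pose k : Cn R n := N%:R^-1 *: h.
have kE : `|k| = `|h| / N%:R by rewrite normrZ gtr0_norm ?invr_gt0// mulrC.
have kr : `|k| <= r1.
  rewrite kE ler_pdivrMr// mulrC -ler_pdivrMr//; apply: ltW.
  apply: lt_le_trans (archi_boundP _) _; first by rewrite divr_ge0// ltW.
  by rewrite ler_nat.
have iterated j : (green M (z + j%:R *: k)%R <= green M z + (j%:R * (A * `|k|))%:E)%E.
  elim: j => [|j IH]; first by rewrite scale0r addr0 mul0r adde0.
  have -> : z + j.+1%:R *: k = z + j%:R *: k + k.
    by rewrite -natr1 scalerDl scale1r addrA.
  apply: le_trans (green_translate H _ kr) _.
  have -> : (j.+1%:R * (A * `|k|))%:E = ((j%:R * (A * `|k|))%:E + (A * `|k|)%:E)%E.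
    by rewrite -EFinD -natr1 mulrDl mul1r.
  by rewrite addeA leeD2r.
have := iterated N; rewrite /k scalerA divff ?gt_eqF// scale1r -/k kE.
by have -> : N%:R * (A * (`|h| / N%:R)) = A * `|h| by field; rewrite gt_eqF.
Qed.

End GreenFunction.

Theorem mainTheorem1 (R : realType) (n m : nat) (M : set (Cn R n))
    (n_gt0 : (0 < n)%N)
    (M_nonempty : M !=set0)
    (M_compact : compact M)
    (M_submanifold : C2_submanifold m M)
    (M_generic : generic M) :
  (forall z, green M z \is a fin_num) /\
  exists A : R, 0 < A /\
    forall z w : Cn R n,
      `|fine (green M z) - fine (green M w)| <= A * enorm (z - w).
Proof.
have discs := uniform_discs M_compact M_submanifold M_generic.
have [r1 [A [r10 A0 lip]]] := uniform_lipschitz M_compact M_nonempty discs.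
have VL := green_lipschitz r10 lip.
have fin z : green M z \is a fin_num.
  have [p Mp] := M_nonempty; rewrite fin_numElt.
  rewrite (lt_le_trans (ltNyr 0) (green_ge0 M z))/=.
  have := VL p (z - p); rewrite addrC subrK => /le_lt_trans; apply.
  apply: le_lt_trans (leeD2r _ (green_on Mp)) _; by rewrite add0e ltry.
split => //; exists A; split => // z w.
have half x y : fine (green M x) - fine (green M y) <= A * `|x - y|.
  have := VL y (x - y); rewrite addrC subrK.
  rewrite -(fineK (fin x)) -(fineK (fin y)) -EFinD lee_fin /=; lra.
apply: (@le_trans _ _ (A * `|z - w|)); last by rewrite ler_pM2l// norm_le_enorm.
rewrite ler_norml half andbT.
by have := half w z; rewrite distrC; lra.
Qed.
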